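(* Let the assumptions (A1), (A2), (A3), (A4) stated in the context be satisfied, and let the sequences $\{\xi^{x,k+1}_y\}$ and $\{\xi^{y,k+1}_x\}$ be generated by the semismooth Newton method described in the context, applied to the equations $\mathcal F^x_y(\xi^x_y)=0$ and $\mathcal F^y_x(\xi^y_x)=0$, respectively. Then $\{\xi^{x,k+1}_y\}$ and $\{\xi^{y,k+1}_x\}$ converge $q$-superlinearly to the unique solutions $\hat\xi^x_y\in\mathcal D^x$ of $\mathcal F^x_y(\xi)=0$ and $\hat\xi^y_x\in\mathcal D^y$ of $\mathcal F^y_x(\xi)=0$, respectively, i.e., as $k\to\infty$, $$\|\xi^{x,k+1}_y-\hat\xi^x_y\|=o(\|\xi^{x,k}_y-\hat\xi^x_y\|),\qquad \|\xi^{y,k+1}_x-\hat\xi^y_x\|=o(\|\xi^{y,k}_x-\hat\xi^y_x\|).$$ Moreover, if in addition the $\nu$-order semismoothness assumptions (A5) and (A6) of the context hold with some $\nu\in(0,1]$, then for all $k$ sufficiently large $$\|\xi^{x,k+1}_y-\hat\xi^x_y\|=O(\|\xi^{x,k}_y-\hat\xi^x_y\|^{1+\min\{\tau,\nu\}}),\qquad \|\xi^{y,k+1}_x-\hat\xi^y_x\|=O(\|\xi^{y,k}_x-\hat\xi^y_x\|^{1+\min\{\tau,\nu\}}),$$ where $\tau\in(0,1]$ is the parameter of the method.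
   Context: **Functions.** $g_i:\mathbb R^n\to\mathbb R$, $h_i:\mathbb R^m\to\mathbb R$, $f_i:\mathbb R^n\times\mathbb R^m\to\mathbb R$ ($i\in[N]=\{1,\dots,N\}$) are continuously differentiable; $\varphi:\mathbb R^n\to(-\infty,\infty]$, $\psi:\mathbb R^m\to(-\infty,\infty]$ are closed, convex, proper; $A\in\mathbb R^{q\times n},B\in\mathbb R^{q\times m},c\in\mathbb R^q$; $g,h,f$ denote the averages $\frac1N\sum_i g_i$, etc. $L(x,y,\lambda)=\varphi(x)+g(x)+f(x,y)-h(y)-\psi(y)+\langle\lambda,Ax+By+c\rangle$. $\phi^x_{y,i}(x):=g_i(x)+f_i(x,y)$ (function of $x$, $y$ fixed), $\phi^y_{x,i}(y):=h_i(y)-f_i(x,y)$ (function of $y$, $x$ fixed); $(\phi^x_{y,i})^*$, $(\phi^y_{x,i})^*$ are their convex conjugates in $x$, respectively $y$; $\mathcal D_i^x:=\mathrm{int}(\mathrm{dom}(\phi^x_{y,i})^* )$, $\mathcal D_i^y:=\mathrm{int}(\mathrm{dom}(\phi^y_{x,i})^* )$. $\mathrm{prox}_\theta(x)=\arg\min_z\{\theta(z)+\frac12\|x-z\|^2\}$, $\mathrm{env}_\theta(x)=\min_z\{\theta(z)+\frac12\|x-z\|^2\}$. $\partial$ of a locally Lipschitz map is Clarke's generalized Jacobian. **Semismoothness.** A locally Lipschitz $F$ on an open set is semismooth at $x$ if it is directionally differentiable at $x$ and $\sup_{M\in\partial F(x+s)}\|F(x+s)-F(x)-Ms\|=o(\|s\|)$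 as $s\to0$; it is $\nu$-order semismooth if the right side is $O(\|s\|^{1+\nu})$. **(A1)** $g_i,h_i$ are convex, $f_i$ is convex in $x$ and concave in $y$, and there are $L_g^i,L_h^i,L_f^i>0$ such that for all $(x,y),(x',y')$: $\|\nabla g_i(x')-\nabla g_i(x)\|\le L_g^i\|x'-x\|$, $\|\nabla h_i(y')-\nabla h_i(y)\|\le L_h^i\|y'-y\|$, $\max\{\|\nabla_xf_i(x',y')-\nabla_xf_i(x,y)\|,\|\nabla_yf_i(x',y')-\nabla_yf_i(x,y)\|\}\le L_f^i\|(x',y')-(x,y)\|$. For each $i$ and fixed $y$, $g_i(x)+f_i(x,y)$ is $\mu_x^i$-strongly convex in $x$; for fixed $x$, $-h_i(y)+f_i(x,y)$ is $\mu_y^i$-strongly concave in $y$ ($\mu_x^i,\mu_y^i>0$). **(A2)** $L$ is closed and admits a saddle point $(x^*,y^*,\lambda^* )\in\mathbb R^n\times\mathbb R^m\times\mathbb R^q$: $L(x^*,y,\lambda^* )\le L(x^*,y^*,\lambda^* )\le L(x,y^*,\lambda)$ for all $x,y,\lambda$. **(A3)** $(\phi^x_{y,i})^*$, $(\phi^y_{x,i})^*$ are essentially differentiable with locally Lipschitz continuous gradients on $\mathcal D_i^x\neq\emptyset$, $\mathcal D_i^y\ne\emptyset$, $i\in[N]$. (A proper closed convex function is essentially differentiable if the interior of its domain is nonempty, it is differentiable there, and the gradient norm tends to infinity along sequences in the interior converging to a boundary point of the domain.) **(A4)** $\nabla(\phi^x_{y,i})^*$, $\nabla(\phi^y_{x,i})^*$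 are semismooth on $\mathcal D_i^x$, $\mathcal D_i^y$ for all $i$. Standing throughout: $\mathrm{prox}_{\alpha\varphi}$ and $\mathrm{prox}_{\alpha\psi}$ are semismooth on $\mathbb R^n$, $\mathbb R^m$ for all $\alpha>0$. **(A5)** $\mathrm{prox}_{\alpha\varphi}$ and $\mathrm{prox}_{\alpha\psi}$ are $\nu$-order semismooth on $\mathbb R^n$, $\mathbb R^m$ for any $\alpha>0$. **(A6)** $\nabla(\phi^x_{y,i})^*$ and $\nabla(\phi^y_{x,i})^*$ are $\nu$-order semismooth on $\mathcal D^x_i$, $\mathcal D^y_i$ for all $i$. **Subproblems.** Fix a $b$-tuple $\mathcal S=(\kappa(1),\dots,\kappa(b))$ of elements of $[N]$, $\alpha>0$, base points $x,\hat v^x\in\mathbb R^n$ and $y,\hat v^y\in\mathbb R^m$, and the fixed arguments $y$, $x$ of the functions $\phi^x_{y,\kappa(i)}$, $\phi^y_{x,\kappa(i)}$. Let $\mathcal D^x=\prod_{i=1}^b\mathcal D^x_{\kappa(i)}$, $\mathcal D^y=\prod_{i=1}^b\mathcal D^y_{\kappa(i)}$. For $\xi=(\xi_1,\dots,\xi_b)\in\mathcal D^x$ let $z^x(\xi)=x-\frac\alpha b\sum_i\xi_i-\hat v^x$ and $\mathcal F^x_{y,i}(\xi)=\nabla(\phi^x_{y,\kappa(i)})^*(\xi_i)-\mathrm{prox}_{\alpha\varphi}(z^x(\xi))$, $i\in[b]$, $\mathcal F^x_y=(\mathcal F^x_{y,1},\dots,\mathcal F^x_{y,b})$; $\mathcal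 I^x_y(\xi)=\sum_{i=1}^b(\phi^x_{y,\kappa(i)})^*(\xi_i)+\frac b{2\alpha}\|z^x(\xi)\|^2-\frac b\alpha\mathrm{env}_{\alpha\varphi}(z^x(\xi))$, which satisfies $\nabla\mathcal I^x_y=\mathcal F^x_y$ on $\mathcal D^x$. The objects $\mathcal F^y_x,\mathcal I^y_x$ on $\mathcal D^y$ are analogous with $\phi^y_{x,\kappa(i)}$, $\psi$, $z^y(\xi)=y-\frac\alpha b\sum_i\xi_i-\hat v^y$. The surrogate differential $\hat\partial\mathcal F^x_y(\xi)$ is the set of matrices $\mathrm{blkdiag}(H_1,\dots,H_b)+\alpha b\,\mathcal A U\mathcal A^\top$ with $H_i\in\partial(\nabla(\phi^x_{y,\kappa(i)})^* )(\xi_i)$, $U\in\partial\mathrm{prox}_{\alpha\varphi}(z^x(\xi))$, $\mathcal A=\frac1b[I,\dots,I]^\top$; $\hat\partial\mathcal F^y_x$ is analogous. **Semismooth Newton method** (for $\mathcal I=\mathcal I^x_y$, $\mathcal F=\mathcal F^x_y$, $\mathcal D=\mathcal D^x$, or the $y$ version). Parameters $\hat\gamma\in(0,\frac12)$, $\rho,\tau_1,\tau_2\in(0,1)$, $\tau\in(0,1]$; start $\xi^0\in\mathcal D$. At iteration $j$: choose $\mathcal W_j\in\hat\partial\mathcal F(\xi^j)$; set $\eta_j=\tau_1\min\{\tau_2,\|\mathcal F(\xi^j)\|\}$; compute by the conjugate gradient method a $d^j$ with $\|(\mathcal W_j+\eta_jI)d^j+\mathcal F(\xi^j)\|\le\min\{\eta_j,\|\mathcal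 F(\xi^j)\|^{1+\tau}\}$; let $\ell_j\ge0$ be the smallest integer such that $\xi^j+\rho^{\ell_j}d^j\in\mathcal D$ and $\mathcal I(\xi^j+\rho^{\ell_j}d^j)\le\mathcal I(\xi^j)+\hat\gamma\rho^{\ell_j}\langle\nabla\mathcal I(\xi^j),d^j\rangle$; set $\xi^{j+1}=\xi^j+\rho^{\ell_j}d^j$. The method is considered without stopping tolerance, so that it generates an infinite sequence; its iterates are denoted $\xi^{x,k}_y$ (respectively $\xi^{y,k}_x$). *)

(* Defs.v *)
From HB Require Import structures.
From mathcomp Require Import all_boot all_order all_algebra.
From mathcomp Require Import all_classical all_reals all_analysis.

Set Implicit Arguments.
Unset Strict Implicit.
Unset Printing Implicit Defensive.

Import Order.TTheory GRing.Theory Num.Theory.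
Import numFieldNormedType.Exports.

Local Open Scope classical_set_scope.
Local Open Scope ring_scope.

(* Vectors of R^n are row vectors and a square matrix M acts by v *m M, as in
   the library's jacobian 'J.  Square matrices standing for (elements of)
   Jacobians or linear systems are thus the transposes of the ones that act on
   column vectors. *)

Section Euclidean.
Context {R : realType}.

Definition inner n (u v : 'rV[R]_n) : R := \sum_i u 0 i * v 0 i.

(* The library norm `|u| of a matrix is the max norm; it induces the same
   topology (hence the same limits and derivatives) as this one. *)
Definition enorm n (u : 'rV[R]_n) : R := Num.sqrt (inner u u).

Definition grad n (f : 'rV[R]_n -> R) (x : 'rV[R]_n) : 'rV[R]_n :=
  \row_i 'd (f : 'rV[R]_n -> R^o) x (delta_mx 0 i).

Definition grad1 n m (f : 'rV[R]_n -> 'rV[R]_m -> R) x y : 'rV[R]_n :=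
  grad (f^~ y) x.

Definition grad2 n m (f : 'rV[R]_n -> 'rV[R]_m -> R) x y : 'rV[R]_m :=
  grad (f x) y.

Definition C1 n (f : 'rV[R]_n -> R) : Prop :=
  (forall x, differentiable (f : 'rV[R]_n -> R^o) x) /\ continuous (grad f).

Definition C1_2 n m (f : 'rV[R]_n -> 'rV[R]_m -> R) : Prop :=
  [/\ forall p, differentiable
        ((fun p => f p.1 p.2) : 'rV[R]_n * 'rV[R]_m -> R^o) p,
      continuous (fun p : 'rV[R]_n * 'rV[R]_m => grad1 f p.1 p.2)
    & continuous (fun p : 'rV[R]_n * 'rV[R]_m => grad2 f p.1 p.2)].

End Euclidean.

Section Convexity.
Context {R : realType}.

Definition convex n (f : 'rV[R]_n -> R) : Prop :=
  convex_function (setT : set (convex_lmodType 'rV[R]_n)) f.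

Definition concave n (f : 'rV[R]_n -> R) : Prop := convex (fun x => - f x).

Definition strongly_convex n (mu : R) (f : 'rV[R]_n -> R) : Prop :=
  forall (x y : 'rV[R]_n) (t : R), 0 <= t <= 1 ->
    f (t *: x + (1 - t) *: y) <=
    t * f x + (1 - t) * f y - mu / 2 * t * (1 - t) * enorm (x - y) ^+ 2.

Definition strongly_concave n (mu : R) (f : 'rV[R]_n -> R) : Prop :=
  strongly_convex mu (fun x => - f x).

Definition dom n (f : 'rV[R]_n -> \bar R) : set 'rV[R]_n :=
  [set x | (f x < +oo)%E].

Definition closed_convex_proper n (f : 'rV[R]_n -> \bar R) : Prop :=
  [/\ lower_semicontinuous f,
      forall (x y : 'rV[R]_n) (t : R), 0 < t < 1 ->
        (f (t *: x + (1 - t) *: y)%R <= t%:E * f x + (1 - t)%:E * f y)%E,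
      forall x, f x != -oo%E
    & dom f !=set0].

Definition conj n (f : 'rV[R]_n -> R) (xi : 'rV[R]_n) : \bar R :=
  ereal_sup [set (inner xi x - f x)%:E | x in setT].

Definition intdom_conj n (f : 'rV[R]_n -> R) : set 'rV[R]_n :=
  (dom (conj f))°.

(* Only meaningful on [intdom_conj f], where [conj f] is finite around xi. *)
Definition grad_conj n (f : 'rV[R]_n -> R) (xi : 'rV[R]_n) : 'rV[R]_n :=
  grad (fine \o conj f) xi.

Definition essentially_differentiable n (f : 'rV[R]_n -> \bar R) : Prop :=
  [/\ closed_convex_proper f,
      (dom f)° !=set0,
      forall x, (dom f)° x -> differentiable (fine \o f : 'rV[R]_n -> R^o) x
    & forall (u : nat -> 'rV[R]_n) (x : 'rV[R]_n),
        (forall k, (dom f)° (u k)) -> u @ \oo --> x ->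
        (closure (dom f) `\` (dom f)°) x ->
        (fun k => enorm (grad (fine \o f) (u k))) @ \oo --> +oo].

Definition prox n (theta : 'rV[R]_n -> \bar R) (x : 'rV[R]_n) : 'rV[R]_n :=
  get [set z | forall w,
    (theta z + (2^-1 * enorm (x - z) ^+ 2)%:E <=
     theta w + (2^-1 * enorm (x - w) ^+ 2)%:E)%E].

Definition env n (theta : 'rV[R]_n -> \bar R) (x : 'rV[R]_n) : \bar R :=
  ereal_inf [set (theta z + (2^-1 * enorm (x - z) ^+ 2)%:E)%E | z in setT].

Definition escale n (a : R) (theta : 'rV[R]_n -> \bar R) : 'rV[R]_n -> \bar R :=
  fun x => (a%:E * theta x)%E.

End Convexity.

Section Semismooth.
Context {R : realType}.

Definition locally_lipschitz n p (D : set 'rV[R]_n) (F : 'rV[R]_n -> 'rV[R]_p) :=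
  forall x, D x -> exists2 U, nbhs x U & [lipschitz F z | z in U `&` D].

Definition convex_hull (V : lmodType R) (A : set V) : set V :=
  [set v | exists (k : nat) (w : 'I_k -> R) (a : 'I_k -> V),
    [/\ forall i, 0 <= w i, \sum_i w i = 1, forall i, A (a i)
      & v = \sum_i w i *: a i]].

(* Clarke's generalized Jacobian of a map that is Lipschitz around x. *)
Definition clarke n p (F : 'rV[R]_n -> 'rV[R]_p) (x : 'rV[R]_n)
    : set 'M[R]_(n, p) :=
  convex_hull [set M : 'M[R]_(n, p) | exists u : nat -> 'rV[R]_n,
    [/\ forall k, differentiable F (u k), u @ \oo --> x
      & (fun k => 'J F (u k)) @ \oo --> M]].

Definition directionally_differentiable n p (F : 'rV[R]_n -> 'rV[R]_p)
    (x : 'rV[R]_n) : Prop :=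
  forall h : 'rV[R]_n, cvg ((fun t : R => t^-1 *: (F (x + t *: h) - F x)) @ 0^'+).

Definition semismooth_gap n p (F : 'rV[R]_n -> 'rV[R]_p) (x s : 'rV[R]_n)
    : \bar R :=
  ereal_sup [set (enorm (F (x + s) - F x - s *m M))%:E
             | M in clarke F (x + s)].

Definition semismooth_at n p (F : 'rV[R]_n -> 'rV[R]_p) (x : 'rV[R]_n) : Prop :=
  directionally_differentiable F x /\
  forall eps : R, 0 < eps ->
    \forall s \near (0 : 'rV[R]_n), (semismooth_gap F x s <= (eps * enorm s)%:E)%E.

Definition nu_semismooth_at n p (nu : R) (F : 'rV[R]_n -> 'rV[R]_p)
    (x : 'rV[R]_n) : Prop :=
  directionally_differentiable F x /\
  exists C : R, \forall s \near (0 : 'rV[R]_n),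
    (semismooth_gap F x s <= (C * enorm s `^ (1 + nu))%:E)%E.

Definition semismooth_on n p (D : set 'rV[R]_n) (F : 'rV[R]_n -> 'rV[R]_p) :=
  locally_lipschitz D F /\ forall x, D x -> semismooth_at F x.

Definition nu_semismooth_on n p (nu : R) (D : set 'rV[R]_n)
    (F : 'rV[R]_n -> 'rV[R]_p) :=
  locally_lipschitz D F /\ forall x, D x -> nu_semismooth_at nu F x.

End Semismooth.

Section Assumptions.
Context {R : realType} {n m q N : nat}.
Implicit Types (g : 'I_N -> 'rV[R]_n -> R) (h : 'I_N -> 'rV[R]_m -> R)
  (f : 'I_N -> 'rV[R]_n -> 'rV[R]_m -> R).

Definition phix g f (y : 'rV[R]_m) (i : 'I_N) : 'rV[R]_n -> R :=
  fun x => g i x + f i x y.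

Definition phiy h f (x : 'rV[R]_n) (i : 'I_N) : 'rV[R]_m -> R :=
  fun y => h i y - f i x y.

Definition pair_norm (u : 'rV[R]_n) (v : 'rV[R]_m) : R :=
  Num.sqrt (enorm u ^+ 2 + enorm v ^+ 2).

Definition assumption_A1 g h f : Prop := forall i : 'I_N,
  [/\ convex (g i), convex (h i),
      forall y, convex (f i ^~ y)
    & forall x, concave (f i x)] /\
  exists Lg Lh Lf mux muy : R,
  [/\ 0 < Lg, 0 < Lh, 0 < Lf, 0 < mux & 0 < muy] /\
  [/\ forall x x', enorm (grad (g i) x' - grad (g i) x) <= Lg * enorm (x' - x),
      forall y y', enorm (grad (h i) y' - grad (h i) y) <= Lh * enorm (y' - y),
      forall x y x' y',
        Num.max (enorm (grad1 (f i) x' y' - grad1 (f i) x y))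
                (enorm (grad2 (f i) x' y' - grad2 (f i) x y))
          <= Lf * pair_norm (x' - x) (y' - y),
      forall y, strongly_convex mux (fun x => g i x + f i x y)
    & forall x, strongly_concave muy (fun y => - h i y + f i x y)].

(* Where phi x = psi y = +oo the expression is of the form oo - oo; the
   library's addition gives -oo there. *)
Definition lagrangian g h f (phi : 'rV[R]_n -> \bar R) (psi : 'rV[R]_m -> \bar R)
    (A : 'M[R]_(q, n)) (B : 'M[R]_(q, m)) (c : 'rV[R]_q)
    (x : 'rV[R]_n) (y : 'rV[R]_m) (lam : 'rV[R]_q) : \bar R :=
  (phi x
   + (N%:R^-1 * (\sum_i g i x) + N%:R^-1 * (\sum_i f i x y)
      - N%:R^-1 * (\sum_i h i y))%:E
   - psi y
   + (inner lam (x *m A^T + y *m B^T + c))%:E)%E.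

(* A function minimized over (x, lam) and maximized over y is closed when its
   minimization sections and the opposites of its maximization sections are.
   The variable held fixed ranges over the effective domain, so that no section
   involves the undetermined form oo - oo. *)
Definition closed_saddle (phi : 'rV[R]_n -> \bar R) (psi : 'rV[R]_m -> \bar R)
    (L : 'rV[R]_n -> 'rV[R]_m -> 'rV[R]_q -> \bar R) : Prop :=
  (forall y, dom psi y ->
     lower_semicontinuous (fun p : 'rV[R]_n * 'rV[R]_q => L p.1 y p.2)) /\
  (forall x lam, dom phi x -> lower_semicontinuous (fun y => (- L x y lam)%E)).

Definition saddle_point (L : 'rV[R]_n -> 'rV[R]_m -> 'rV[R]_q -> \bar R)
    (xs : 'rV[R]_n) (ys : 'rV[R]_m) (lams : 'rV[R]_q) : Prop :=
  forall x y lam,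
    (L xs y lams <= L xs ys lams)%E /\ (L xs ys lams <= L x ys lam)%E.

Definition assumption_A2 g h f (phi : 'rV[R]_n -> \bar R)
    (psi : 'rV[R]_m -> \bar R)
    (A : 'M[R]_(q, n)) (B : 'M[R]_(q, m)) (c : 'rV[R]_q) : Prop :=
  let L := lagrangian g h f phi psi A B c in
  closed_saddle phi psi L /\ exists xs ys lams, saddle_point L xs ys lams.

Definition conj_regular k (p : 'rV[R]_k -> R) : Prop :=
  [/\ essentially_differentiable (conj p), intdom_conj p !=set0
    & locally_lipschitz (intdom_conj p) (grad_conj p)].

Definition assumption_A3 g h f : Prop :=
  (forall i y, conj_regular (phix g f y i)) /\
  (forall i x, conj_regular (phiy h f x i)).

Definition assumption_A4 g h f : Prop :=
  (forall i y, semismooth_on (intdom_conj (phix g f y i))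
                             (grad_conj (phix g f y i))) /\
  (forall i x, semismooth_on (intdom_conj (phiy h f x i))
                             (grad_conj (phiy h f x i))).

Definition prox_semismooth (phi : 'rV[R]_n -> \bar R)
    (psi : 'rV[R]_m -> \bar R) : Prop :=
  forall alpha : R, 0 < alpha ->
    semismooth_on setT (prox (escale alpha phi)) /\
    semismooth_on setT (prox (escale alpha psi)).

Definition assumption_A5 (nu : R) (phi : 'rV[R]_n -> \bar R)
    (psi : 'rV[R]_m -> \bar R) : Prop :=
  forall alpha : R, 0 < alpha ->
    nu_semismooth_on nu setT (prox (escale alpha phi)) /\
    nu_semismooth_on nu setT (prox (escale alpha psi)).

Definition assumption_A6 (nu : R) g h f : Prop :=
  (forall i y, nu_semismooth_on nu (intdom_conj (phix g f y i))
                                   (grad_conj (phix g f y i))) /\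
  (forall i x, nu_semismooth_on nu (intdom_conj (phiy h f x i))
                                   (grad_conj (phiy h f x i))).

End Assumptions.

(* The subproblem for p_1, ..., p_b : R^n -> R (the selected phi^x_{y,kappa(i)},
   resp. phi^y_{x,kappa(i)}), the regularizer theta, the step size alpha, the
   base point x and the shift v.  An element xi = (xi_1, ..., xi_b) of (R^n)^b
   is a row vector of length n + ... + n, with blocks xi_i = submxrow xi i. *)
Section Subproblem.
Context {R : realType} {n b : nat}.
Variables (p : 'I_b -> 'rV[R]_n -> R) (theta : 'rV[R]_n -> \bar R).
Variables (alpha : R) (x v : 'rV[R]_n).

Definition sub_dom : set 'rV[R]_(\sum_(i < b) n) :=
  [set xi | forall i, intdom_conj (p i) (submxrow xi i)].

Definition sub_z (xi : 'rV[R]_(\sum_(i < b) n)) : 'rV[R]_n :=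
  x - (alpha / b%:R) *: (\sum_i submxrow xi i) - v.

Definition sub_F (xi : 'rV[R]_(\sum_(i < b) n)) : 'rV[R]_(\sum_(i < b) n) :=
  \mxrow_i (grad_conj (p i) (submxrow xi i)
            - prox (escale alpha theta) (sub_z xi)).

Definition sub_I (xi : 'rV[R]_(\sum_(i < b) n)) : R :=
  \sum_i fine (conj (p i) (submxrow xi i))
  + b%:R / (2 * alpha) * enorm (sub_z xi) ^+ 2
  - b%:R / alpha * fine (env (escale alpha theta) (sub_z xi)).

Definition sub_A : 'M[R]_(\sum_(i < b) n, n) :=
  b%:R^-1 *: \mxcol_(i < b) (1%:M : 'M[R]_n).

Definition sub_dF (xi : 'rV[R]_(\sum_(i < b) n))
    : set 'M[R]_(\sum_(i < b) n) :=
  [set W | exists (H : 'I_b -> 'M[R]_n) (U : 'M[R]_n),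
    [/\ forall i, clarke (grad_conj (p i)) (submxrow xi i) (H i),
        clarke (prox (escale alpha theta)) (sub_z xi) U
      & W = \mxdiag_i H i + (alpha * b%:R) *: (sub_A *m U *m sub_A^T)]].

End Subproblem.

Section Newton.
Context {R : realType} {d : nat}.

(* Conjugate gradient (Hestenes-Stiefel) for  u *m M = rhs, started at u = 0;
   the state is (iterate, residual, search direction).  Once the residual
   vanishes the iteration is stationary, since 0 / 0 = 0. *)
Definition cg_step (M : 'M[R]_d) (st : 'rV[R]_d * 'rV[R]_d * 'rV[R]_d)
    : 'rV[R]_d * 'rV[R]_d * 'rV[R]_d :=
  let: (u, r, s) := st in
  let a := inner r r / inner s (s *m M) in
  let r' := r - a *: (s *m M) in
  (u + a *: s, r', r' + (inner r' r' / inner r r) *: s).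

Definition cg_iterate (M : 'M[R]_d) (rhs : 'rV[R]_d) (k : nat) : 'rV[R]_d :=
  (iter k (cg_step M) (0, rhs, rhs)).1.1.

Variables (D : set 'rV[R]_d) (I : 'rV[R]_d -> R) (F : 'rV[R]_d -> 'rV[R]_d)
  (dF : 'rV[R]_d -> set 'M[R]_d).
Variables (gamma rho tau1 tau2 tau : R).

Definition armijo (xi dir : 'rV[R]_d) (l : nat) : Prop :=
  D (xi + rho ^+ l *: dir) /\
  I (xi + rho ^+ l *: dir) <= I xi + gamma * rho ^+ l * inner (grad I xi) dir.

Definition newton_step (xi xi' : 'rV[R]_d) : Prop :=
  exists (W : 'M[R]_d) (dir : 'rV[R]_d) (l : nat),
  let eta := tau1 * Num.min tau2 (enorm (F xi)) in
  [/\ dF xi W,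
      exists k, dir = cg_iterate (W + eta%:M) (- F xi) k,
      enorm (dir *m (W + eta%:M) + F xi)
        <= Num.min eta (enorm (F xi) `^ (1 + tau)),
      armijo xi dir l /\ (forall l', (l' < l)%N -> ~ armijo xi dir l')
    & xi' = xi + rho ^+ l *: dir].

Definition newton_sequence (xi : nat -> 'rV[R]_d) : Prop :=
  D (xi 0%N) /\ forall j, newton_step (xi j) (xi j.+1).

End Newton.

Section Rates.
Context {R : realType} {d : nat}.

Definition error (xi : nat -> 'rV[R]_d) (xhat : 'rV[R]_d) : nat -> R^o :=
  fun k => enorm (xi k - xhat).

Definition unique_solution (D : set 'rV[R]_d) (F : 'rV[R]_d -> 'rV[R]_d)
    (xhat : 'rV[R]_d) : Prop :=
  [/\ D xhat, F xhat = 0 & forall xi, D xi -> F xi = 0 -> xi = xhat].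

Definition q_superlinear (xi : nat -> 'rV[R]_d) (xhat : 'rV[R]_d) : Prop :=
  xi @ \oo --> xhat /\
  (fun k => error xi xhat k.+1) =o_\oo error xi xhat.

Definition q_rate (s : R) (xi : nat -> 'rV[R]_d) (xhat : 'rV[R]_d) : Prop :=
  (fun k => error xi xhat k.+1) =O_\oo
    ((fun k => error xi xhat k `^ s) : nat -> R^o).

End Rates.

(* Main.v *)
Require Import Defs.
From HB Require Import structures.
From mathcomp Require Import all_boot all_order all_algebra.
From mathcomp Require Import all_classical all_reals all_analysis.
From mathcomp Require Import ring lra.

(** Every selected function p (one of the phi^x_{y,i} or phi^y_{x,i}) is
    strongly convex with Lipschitz gradient.  Hence the supremum defining its
    conjugate is attained for every dual vector: the conjugate is finite
    everywhere, the domain of the subproblem is the whole space, and the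
    gradient of the conjugate, being the argmax map, is Lipschitz and strongly
    monotone ([convex_gradient_conj]).  Likewise prox is the Lipschitz gradient
    of the convex function |x|^2 / 2 - env(x) ([convex_gradient_env]).
    Adding up the blocks, the objective I of the subproblem is strongly convex
    and its gradient is the Lipschitz map F ([sub_convex_gradient]).

    Jacobians of gradient maps are symmetric and inherit the bounds of strong
    monotonicity and Lipschitz continuity; these properties are closed and
    convex, so they hold for Clarke Jacobians too ([sym_bounded_clarke]), and
    every matrix W of the surrogate differential is symmetric positive definite
    with uniform bounds ([sub_dF_bounded]).

    Global convergence.  Each conjugate gradient step does not increase the
    quadratic model, and the first one decreases it by a multiple of |F|^2; so
    the computed direction d satisfies <F, d> <= - c |F|^2 ([cg_descent]) and
    |d| <= C |F|.  The line search then accepts a step bounded below, each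
    iteration decreases I by a multiple of |F|^2, and F tends to 0 along the
    sequence because I is bounded below.  Strong monotonicity turns this into
    the Cauchy property, and the limit is the unique zero xhat of F
    ([newton_sequence_cvg]).

    Local rate.  With e the current error, the next error e + d satisfies
      (e + d) (W + eta) = - (F(xhat + e) - F(xhat) - e W) + eta e + residual,
    where the first term is o(|e|) by semismoothness (O(|e|^(1+nu)) in the
    nu-order case), the second is O(|e|^2) and the third O(|e|^(1+tau))
    ([newton_direction_error]).  This is the rate of the full step, so the line
    search has to accept the full step eventually ([newton_full_step]).  That
    holds because gamma < 1/2 and, by directional differentiability,
      I(xhat + e) - I(xhat) = <F(xhat + e), e> / 2 + o(|e|^2)
    ([quadratic_expansion]), whereas I(xhat + e + d) - I(xhat) = o(|e|^2). *)

Set Implicit Arguments.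
Unset Strict Implicit.
Unset Printing Implicit Defensive.

Import Order.TTheory GRing.Theory Num.Theory.
Import numFieldNormedType.Exports.

Local Open Scope classical_set_scope.
Local Open Scope ring_scope.

(** * Euclidean inner product and norm *)

Section Entries.
Context {R : realType} {m n : nat}.

Lemma coord_le_norm (M : 'M[R]_(m, n)) i j : `|M i j| <= `|M|.
Proof.
rewrite [leRHS]/Num.norm /= mx_normrE; apply/bigmax_geP; right => /=.
by exists (i, j).
Qed.

Lemma cvg_coord {T : Type} {F : set_system T} {FF : Filter F}
    (h : T -> 'M[R]_(m, n)) (M : 'M[R]_(m, n)) i j :
  h @ F --> M -> (fun t => h t i j) @ F --> (M i j : R).
Proof.
move=> hu; apply/cvgrPdist_lt => e e0; move/cvgrPdist_lt: hu => /(_ _ e0).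
apply: filterS => t; apply: le_lt_trans; apply: le_trans (coord_le_norm _ i j).
by rewrite !mxE.
Qed.

Lemma cvg_mulmxl {T : Type} {F : set_system T} {FF : Filter F}
    (h : T -> 'M[R]_(m, n)) (M : 'M[R]_(m, n)) (u : 'rV[R]_m) (v : 'rV[R]_n) :
  h @ F --> M -> (fun t => inner (u *m h t) v) @ F --> inner (u *m M) v.
Proof.
move=> hM; apply: cvg_big => [|j _]; first exact: add_continuous.
apply: cvgM; last exact: cvg_cst.
rewrite mxE; under eq_cvg do rewrite mxE.
apply: cvg_big => [|i _]; first exact: add_continuous.
by apply: cvgM; [exact: cvg_cst|exact: cvg_coord].
Qed.

End Entries.

Arguments cvg_mulmxl {R m n T F FF h M} u v.

Section EuclideanSpace.
Context {R : realType} {n : nat}.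
Implicit Types (u v w : 'rV[R]_n) (a : R).

Lemma innerC u v : inner u v = inner v u.
Proof. by apply: eq_bigr => i _; rewrite mulrC. Qed.

Lemma innerDl u v w : inner (u + v) w = inner u w + inner v w.
Proof.
by rewrite /inner -big_split; apply: eq_bigr => i _; rewrite mxE mulrDl.
Qed.

Lemma innerZl a u v : inner (a *: u) v = a * inner u v.
Proof. by rewrite /inner mulr_sumr; apply: eq_bigr => i _; rewrite mxE mulrA. Qed.

Lemma innerDr u v w : inner w (u + v) = inner w u + inner w v.
Proof. by rewrite !(innerC w) innerDl. Qed.

Lemma innerZr a u v : inner u (a *: v) = a * inner u v.
Proof. by rewrite !(innerC u) innerZl. Qed.

Lemma innerNl u v : inner (- u) v = - inner u v.
Proof. by rewrite -scaleN1r innerZl mulN1r. Qed.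

Lemma innerNr u v : inner u (- v) = - inner u v.
Proof. by rewrite !(innerC u) innerNl. Qed.

Lemma inner0l u : inner 0 u = 0.
Proof. by rewrite -(scale0r 0) innerZl mul0r. Qed.

Lemma inner0r u : inner u 0 = 0.
Proof. by rewrite innerC inner0l. Qed.

Definition innerE := (innerDl, innerDr, innerZl, innerZr, innerNl, innerNr,
  inner0l, inner0r).

Lemma inner_ge0 u : 0 <= inner u u.
Proof. by apply: sumr_ge0 => i _; rewrite -expr2 sqr_ge0. Qed.

Lemma inner_mulmx u v : inner u v = (u *m v^T) 0 0.
Proof. by rewrite mxE; apply: eq_bigr => i _; rewrite mxE. Qed.

Lemma sqr_enorm u : enorm u ^+ 2 = inner u u.
Proof. by rewrite sqr_sqrtr // inner_ge0. Qed.

Lemma enorm_ge0 u : 0 <= enorm u.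
Proof. exact: sqrtr_ge0. Qed.

Lemma enorm0 : enorm (0 : 'rV[R]_n) = 0.
Proof. by rewrite /enorm inner0l sqrtr0. Qed.

Lemma inner_eq0 u : inner u u = 0 -> u = 0.
Proof.
move=> /eqP; rewrite psumr_eq0 => [/allP u0|i _]; last by rewrite -expr2 sqr_ge0.
apply/rowP => i; have := u0 i (mem_index_enum _).
by rewrite mulf_eq0 orbb mxE => /eqP.
Qed.

Lemma enorm_eq0 u : enorm u = 0 -> u = 0.
Proof. by move=> u0; apply: inner_eq0; rewrite -sqr_enorm u0 expr0n. Qed.

Lemma enorm_gt0 u : (0 < enorm u) = (u != 0).
Proof.
rewrite lt_neqAle enorm_ge0 andbT eq_sym; congr (~~ _).
by apply/eqP/eqP => [/enorm_eq0|->] //; rewrite enorm0.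
Qed.

Lemma enormZ a u : enorm (a *: u) = `|a| * enorm u.
Proof. by rewrite /enorm innerZl innerZr mulrA -expr2 sqrtrM ?sqr_ge0//
  sqrtr_sqr. Qed.

Lemma enormN u : enorm (- u) = enorm u.
Proof. by rewrite /enorm innerNl innerNr opprK. Qed.

Lemma enormB u v : enorm (u - v) = enorm (v - u).
Proof. by rewrite -enormN opprB. Qed.

Lemma inner_le u v : inner u v <= enorm u * enorm v.
Proof.
have [->|v0] := eqVneq v 0; first by rewrite inner0r enorm0 mulr0.
have v_gt0 : 0 < enorm v by rewrite enorm_gt0.
(* u minus its orthogonal projection on v has a nonnegative square *)
have := inner_ge0 (inner v v *: u - inner u v *: v).
rewrite !innerE (innerC v u) -!sqr_enorm => h.
have {}h : inner u v ^+ 2 <= (enorm u * enorm v) ^+ 2.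
  rewrite -(ler_pM2l (exprn_gt0 2 v_gt0)); move: h; nra.
apply: le_trans (ler_norm _) _.
by rewrite -(ler_pXn2r (n := 2)) ?nnegrE ?mulr_ge0 ?enorm_ge0 // real_normK ?num_real.
Qed.

Lemma norm_inner_le u v : `|inner u v| <= enorm u * enorm v.
Proof.
rewrite ler_norml inner_le andbT lerNl -innerNl -(enormN u).
exact: inner_le.
Qed.

Lemma enormD u v : enorm (u + v) <= enorm u + enorm v.
Proof.
rewrite -(ler_pXn2r (n := 2)) ?nnegrE ?addr_ge0 ?enorm_ge0 // sqr_enorm.
rewrite !innerE sqrrD !sqr_enorm (innerC v u).
by have := inner_le u v; lra.
Qed.

Lemma enormBD u v : enorm (u - v) <= enorm u + enorm v.
Proof. by rewrite -(enormN v) enormD. Qed.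

Lemma enorm_sum m (F : 'I_m -> 'rV[R]_n) :
  enorm (\sum_i F i) <= \sum_i enorm (F i).
Proof.
elim/big_ind2: _ => // [|x a y b ha hb]; first by rewrite enorm0.
by apply: le_trans (enormD _ _) _; rewrite lerD.
Qed.

Lemma norm_le_enorm u : `|u| <= enorm u.
Proof.
rewrite [leLHS]/Num.norm /= mx_normrE; apply/bigmax_leP; split=> [|[i j] _ /=].
  exact: enorm_ge0.
rewrite ord1 -(ler_pXn2r (n := 2)) ?nnegrE ?enorm_ge0 // sqr_enorm.
rewrite real_normK ?num_real // /inner (bigD1 j) //= -expr2 lerDl.
by apply: sumr_ge0 => k _; rewrite -expr2 sqr_ge0.
Qed.

(** The constant is not optimal; the successor keeps it invertible for n = 0. *)
Lemma enorm_le_norm u : enorm u <= n.+1%:R * `|u|.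
Proof.
have n1 : 1 <= n.+1%:R :> R by rewrite ler1n.
rewrite -(ler_pXn2r (n := 2)) ?nnegrE ?mulr_ge0 ?enorm_ge0 // sqr_enorm exprMn.
apply: (@le_trans _ _ (n%:R * `|u| ^+ 2)).
  rewrite /inner mulr_natl.
  have -> : `|u| ^+ 2 *+ n = \sum_(i < n) `|u| ^+ 2.
    by rewrite sumr_const card_ord.
  apply: ler_sum => i _; rewrite -expr2 -(real_normK (num_real (u 0 i))).
  by rewrite ler_pXn2r ?nnegrE // coord_le_norm.
rewrite ler_wpM2r ?sqr_ge0 // -natrX ler_nat.
by apply: leq_trans (leqnSn _) _; rewrite -[leqLHS]mul1n leq_mul.
Qed.

(** The Euclidean norm and the max norm are equivalent, so neighbourhoods (and
    limits, below) can be tested with the Euclidean one. *)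
Lemma near_enormP u (P : 'rV[R]_n -> Prop) :
  (\forall v \near u, P v) <->
  exists2 d : R, 0 < d & forall v, enorm (v - u) < d -> P v.
Proof.
split=> [/nbhs_ballP[d /= d0 dP]|[d d0 dP]].
  exists d => // v uvd; apply: dP; rewrite -ball_normE /= -normrN opprB.
  exact: le_lt_trans (norm_le_enorm _) uvd.
apply/nbhs_ballP; exists (d / n.+1%:R) => /=; first by rewrite divr_gt0.
move=> v; rewrite -ball_normE /= -normrN opprB => uv.
apply: dP; apply: le_lt_trans (enorm_le_norm _) _.
by rewrite mulrC -ltr_pdivlMr.
Qed.

Lemma near0_enormP (P : 'rV[R]_n -> Prop) :
  (\forall v \near (0 : 'rV[R]_n), P v) <->
  exists2 d : R, 0 < d & forall v, enorm v < d -> P v.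
Proof.
split=> [/near_enormP[d d0 dP]|[d d0 dP]].
  by exists d => // v vd; apply: dP; rewrite subr0.
by apply/near_enormP; exists d => // v; rewrite subr0; apply: dP.
Qed.

Lemma cvg_enormP {T : Type} {F : set_system T} {FF : Filter F}
    (h : T -> 'rV[R]_n) u :
  h @ F --> u <-> (fun t => enorm (h t - u)) @ F --> (0 : R).
Proof.
split=> [hu|hu].
  apply/cvgrPdist_lt => e e0.
  have e1 : 0 < e / n.+1%:R by rewrite divr_gt0.
  move/cvgrPdist_lt: hu => /(_ _ e1); apply: filterS => t ht.
  rewrite sub0r normrN ger0_norm ?enorm_ge0 //.
  apply: le_lt_trans (enorm_le_norm _) _.
  by rewrite mulrC -ltr_pdivlMr // -normrN opprB.
apply/cvgrPdist_lt => e e0; move/cvgrPdist_lt: hu => /(_ _ e0).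
apply: filterS => t; rewrite sub0r normrN ger0_norm ?enorm_ge0 // => ht.
by rewrite -normrN opprB; apply: le_lt_trans (norm_le_enorm _) ht.
Qed.

Lemma ler_dist_enorm u v : `|enorm u - enorm v| <= enorm (u - v).
Proof.
rewrite ler_norml; have := enormD (u - v) v; have := enormBD u (u - v).
by rewrite subrK opprB addrC subrK; clear; lra.
Qed.

Lemma continuous_enormB u : continuous (fun v : 'rV[R]_n => enorm (v - u)).
Proof.
move=> v; apply/(@cvgrPdist_lt _ _ _ (nbhs v)) => e e0; apply/near_enormP.
exists e => // w wv; apply: le_lt_trans wv.
apply: le_trans (ler_dist_enorm _ _) _.
by rewrite opprB addrA subrK enormB.
Qed.

Lemma cvg_inner {T : Type} {F : set_system T} {FF : Filter F}
    (h k : T -> 'rV[R]_n) u v :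
  h @ F --> u -> k @ F --> v -> (fun t => inner (h t) (k t)) @ F --> inner u v.
Proof.
move=> hu kv; apply: cvg_big => [|i _]; first exact: add_continuous.
by apply: cvgM; apply: cvg_coord.
Qed.

End EuclideanSpace.

(** * Gradients, line derivatives and symmetry of second derivatives *)

Section InnerLinear.
Context {R : realType} {n : nat} (g : 'rV[R]_n).

(** Valued in [R^o] so that it can serve as a differential. *)
Definition inner_form (v : 'rV[R]_n) : R^o := inner g v.

Let inner_form_linear : linear inner_form.
Proof. by move=> a u v; rewrite /inner_form innerDr innerZr. Qed.

HB.instance Definition _ :=
  GRing.isLinear.Build R 'rV[R]_n R^o *:%R inner_form inner_form_linear.
End InnerLinear.

Section Gradient.
Context {R : realType} {n : nat}.
Implicit Types (f : 'rV[R]_n -> R) (x y u v : 'rV[R]_n).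

Lemma diff_grad f x v : 'd (f : 'rV[R]_n -> R^o) x v = inner (grad f x) v.
Proof.
rewrite [in LHS](row_sum_delta v) linear_sum; apply: eq_bigr => i _.
by rewrite linearZ /= mxE mulrC.
Qed.

(** Differentials are unique, so a first-order expansion identifies the
    gradient; this is how every gradient below is computed. *)
Lemma gradP f x g :
  (forall e : R, 0 < e -> \forall v \near (0 : 'rV[R]_n),
     `|f (x + v) - f x - inner g v| <= e * enorm v) ->
  differentiable (f : 'rV[R]_n -> R^o) x /\ grad f x = g.
Proof.
move=> fg; have cont_g : continuous (inner_form g).
  move=> v; apply: (@cvg_inner _ _ _ (nbhs v) _ (cst g) id); last exact: cvg_id.
  exact: cvg_cst.
have expansion : (f : 'rV[R]_n -> R^o) \o shift x
    = cst (f x) + inner_form g +o_ (0 : 'rV[R]_n) id.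
  apply/eqaddoP => e e0.
  have e1 : 0 < e / n.+1%:R by rewrite divr_gt0.
  apply: filterS (fg _ e1) => v hv.
  rewrite /= -[X in `|X|]/(f (v + x) - (f x + inner g v)) opprD addrA addrC.
  rewrite addrC [v + x]addrC; apply: le_trans hv _.
  rewrite -mulrA ler_pM2l // mulrC ler_pdivrMr // mulrC.
  exact: enorm_le_norm.
have dE := diff_unique cont_g expansion.
split.
  by apply/diff_locallyP; rewrite dE.
apply/rowP => i; transitivity (inner g (delta_mx 0 i)); first by rewrite mxE dE.
rewrite /inner (bigD1 i) //= big1 => [|j ji]; rewrite mxE eqxx.
  by rewrite eqxx mulr1 addr0.
by rewrite (negbTE ji) mulr0.
Qed.

Lemma near0_mul_sqr (C : R) (e : R) : 0 < e ->
  \forall v \near (0 : 'rV[R]_n), C * enorm v ^+ 2 <= e * enorm v.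
Proof.
move=> e0; apply/near0_enormP.
have C1 : 0 < `|C| + 1 by rewrite ltr_wpDl.
exists (e / (`|C| + 1)); rewrite ?divr_gt0 // => v.
rewrite ltr_pdivlMr // => hv.
rewrite expr2 mulrA ler_wpM2r ?enorm_ge0 //; apply: le_trans (ltW hv).
rewrite mulrC ler_wpM2l ?enorm_ge0 //.
by have := ler_norm C; lra.
Qed.

Lemma grad_expansion f x e :
  differentiable (f : 'rV[R]_n -> R^o) x -> 0 < e ->
  \forall v \near (0 : 'rV[R]_n),
    `|f (x + v) - f x - inner (grad f x) v| <= e * enorm v.
Proof.
move=> /diff_locallyP[_ /eqaddoP/(_ e) fx] e0.
apply: filterS (fx e0) => v /= hv.
rewrite -diff_grad; apply: le_trans (_ : _ <= e * `|v|) _; last first.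
  by rewrite ler_pM2l // norm_le_enorm.
apply: le_trans hv.
by rewrite -[X in _ <= `|X|]/(f (v + x) - (f x + _)) opprD addrA (addrC v).
Qed.

Lemma jacobian_expansion m (G : 'rV[R]_n -> 'rV[R]_m) x e :
  differentiable G x -> 0 < e ->
  \forall v \near (0 : 'rV[R]_n),
    enorm (G (x + v) - G x - v *m 'J G x) <= e * enorm v.
Proof.
move=> /diff_locallyP[_ /eqaddoP/(_ (e / m.+1%:R)) fx] e0.
have e1 : 0 < e / m.+1%:R by rewrite divr_gt0.
apply: filterS (fx e1) => v /= hv.
apply: le_trans (enorm_le_norm _) _; rewrite mulrC -ler_pdivlMr // mulrAC.
apply: le_trans (_ : _ <= e / m.+1%:R * `|v|) _; last first.
  by rewrite ler_pM2l // norm_le_enorm.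
apply: le_trans hv; rewrite /jacobian mul_rV_lin1.
by rewrite -[X in _ <= `|X|]/(G (v + x) - (G x + _)) opprD addrA (addrC v).
Qed.

Lemma is_derive_line f x v (t : R) :
  differentiable (f : 'rV[R]_n -> R^o) (x + t *: v) ->
  is_derive t (1 : R) (fun s : R => f (x + s *: v)) (inner (grad f (x + t *: v)) v).
Proof.
move=> df; rewrite -diff_grad -deriveE //.
have quotientE : (fun h : R => h^-1 *: (((f : _ -> R^o) \o shift (x + t *: v)) (h
  *: v)
      - f (x + t *: v)))
    = (fun h : R => h^-1 *: (((fun s : R => f (x + s *: v)) \o shift t)
        (h *: (1 : R)) - f (x + t *: v))).
  apply/funext => h /=.
  by rewrite -[h *: 1]/(h * 1) mulr1 scalerDl addrCA addrC.
have := @diff_derivable _ _ _ (f : _ -> R^o) (x + t *: v) v df.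
by rewrite /derivable quotientE => cvq; apply: DeriveDef;
  rewrite // /derive quotientE.
Qed.

Lemma is_derive_MVT (F dF : R -> R) :
  (forall t, is_derive t (1 : R) F (dF t)) ->
  exists2 t, 0 < t < 1 & F 1 - F 0 = dF t.
Proof.
move=> dFE; have [|t] := @MVT R F dF 0 1 ltr01 (fun t _ => dFE t).
  apply: continuous_subspaceT => t.
  apply: differentiable_continuous; apply/derivable1_diffP.
  by case: (dFE t).
by rewrite in_itv /= => t01 ->; exists t => //; rewrite subr0 mulr1.
Qed.

Lemma grad_MVT f x v :
  (forall y, differentiable (f : 'rV[R]_n -> R^o) y) ->
  exists2 t, 0 < t < 1 & f (x + v) - f x = inner (grad f (x + t *: v)) v.
Proof.
move=> df; have [|t t01] := @is_derive_MVT (fun t => f (x + t *: v))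
    (fun t => inner (grad f (x + t *: v)) v).
  by move=> t; apply: is_derive_line.
by rewrite scale1r scale0r addr0 => ->; exists t.
Qed.

Let second_difference_rest (a b c u v w : 'rV[R]_n) (J : 'M[R]_n) (t : R) :
  inner (a - b) (t *: v) - t ^+ 2 * inner (u *m J) v
  = t * inner ((a - c - (t *: u + w) *m J) - (b - c - w *m J)) v.
Proof. by rewrite mulmxDl -scalemxAl !innerE; ring. Qed.

(** The mean value theorem applied to s |-> f(x + tu + s tv) - f(x + s tv)
    expresses the second difference through two values of the gradient, both of
    which are expanded at x.  The gradient is differentiable at x but perhaps
    not around x, so symmetry cannot come from continuity of second
    derivatives. *)
Lemma second_difference f x u v e :
  (forall y, differentiable (f : 'rV[R]_n -> R^o) y) ->
  differentiable (grad f) x -> 0 < e ->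
  \forall t \near (0 : R)^'+,
    `|f (x + t *: u + t *: v) - f (x + t *: u) - f (x + t *: v) + f x
      - t ^+ 2 * inner (u *m 'J (grad f) x) v| <= e * t ^+ 2.
Proof.
move=> df dG e0; pose c := enorm u + enorm v + 1.
have c0 : 0 < c by rewrite ltr_wpDl // addr_ge0 ?enorm_ge0.
have [d d0 Gexp] := (near0_enormP _).1
  (jacobian_expansion dG (divr_gt0 (divr_gt0 e0 (ltr0n _ 2)) (mulr_gt0 c0 c0))).
have t0 : 0 < d / c by rewrite divr_gt0.
near=> t.
have [t_gt0 t_lt] : 0 < t /\ t < d / c by split; near: t;
  [exact: nbhs_right_gt|exact: nbhs_right_lt].
have dphi s : is_derive s (1 : R)
   (fun s : R => f (x + t *: u + s *: (t *: v)) - f (x + s *: (t *: v)))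
   (inner (grad f (x + t *: u + s *: (t *: v))) (t *: v)
     - inner (grad f (x + s *: (t *: v))) (t *: v)).
  by apply: is_deriveB; apply: is_derive_line.
have [s s01] := @is_derive_MVT _ _ dphi.
rewrite !scale1r !scale0r !addr0 => diffE.
pose w1 := t *: u + s *: (t *: v); pose w2 := s *: (t *: v).
have bound w : enorm w <= t * (enorm u + enorm v) ->
    enorm (grad f (x + w) - grad f x - w *m 'J (grad f) x) <= e / 2 / c * t.
  move=> hw; have wct : enorm w <= c * t.
    apply: (le_trans hw).
    rewrite [t * _]mulrC.
    rewrite (ler_pM2r t_gt0).
    rewrite /c lerDl.
    exact: ler01.
  apply: le_trans (Gexp w _) _.
    by apply: le_lt_trans wct _; rewrite mulrC -ltr_pdivlMr.
  apply: le_trans (_ : _ <= e / 2 / (c * c) * (c * t)) _.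
    by rewrite ler_wpM2l // ltW // !divr_gt0 // mulr_gt0.
  suff -> : e / 2 / (c * c) * (c * t) = e / 2 / c * t by [].
  by field; rewrite gt_eqF.
have h2 : enorm w2 <= t * enorm v.
  rewrite /w2 !enormZ !gtr0_norm //; last by case/andP: s01.
  by rewrite ler_piMl ?mulr_ge0 ?enorm_ge0 ?(ltW t_gt0) // ltW //; case/andP: s01.
have h1 : enorm w1 <= t * (enorm u + enorm v).
  apply: le_trans (enormD _ _) _; rewrite -/w2 enormZ gtr0_norm //.
  by rewrite mulrDr lerD2l.
have {}h2 : enorm w2 <= t * (enorm u + enorm v).
  by apply: le_trans h2 _; rewrite ler_pM2l // lerDr enorm_ge0.
have {h1}b1 := bound _ h1; have {h2}b2 := bound _ h2.
have -> : f (x + t *: u + t *: v) - f (x + t *: u) - f (x + t *: v) + f x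
   = inner (grad f (x + w1) - grad f (x + w2)) (t *: v).
  by rewrite innerDl innerNl addrA -diffE; ring.
have -> : inner (grad f (x + w1) - grad f (x + w2)) (t *: v)
    - t ^+ 2 * inner (u *m 'J (grad f) x) v
  = t * inner ((grad f (x + w1) - grad f x - w1 *m 'J (grad f) x)
      - (grad f (x + w2) - grad f x - w2 *m 'J (grad f) x)) v.
  exact: second_difference_rest.
rewrite normrM gtr0_norm // mulrC expr2 mulrA ler_pM2r //.
apply: le_trans (norm_inner_le _ _) _.
apply: le_trans (_ : _ <= (e / 2 / c * t + e / 2 / c * t) * c) _.
  apply: ler_pM; rewrite ?enorm_ge0 //.
    by apply: le_trans (enormBD _ _) _; rewrite lerD.
  by rewrite /c addrAC lerDr addr_ge0 ?enorm_ge0.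
suff -> : (e / 2 / c * t + e / 2 / c * t) * c = e * t by [].
by field; rewrite gt_eqF.
Unshelve. all: by end_near. Qed.

(** The second difference is symmetric in u and v, hence so is its limit. *)
Lemma jacobian_grad_sym f x u v :
  (forall y, differentiable (f : 'rV[R]_n -> R^o) y) ->
  differentiable (grad f) x ->
  inner (u *m 'J (grad f) x) v = inner (v *m 'J (grad f) x) u.
Proof.
move=> df dG; apply/eqP; rewrite -subr_eq0 -normr_le0; apply/ler_addgt0Pr => e e0.
rewrite add0r; have e2 : 0 < e / 2 by rewrite divr_gt0.
have [t [[+ +] t0]] := filter_ex (filterI (filterI
  (second_difference u v df dG e2) (second_difference v u df dG e2))
  (nbhs_right_gt (0 : R))).
rewrite [x + t *: v + t *: u]addrAC => ha hb.
rewrite -(@ler_pM2r _ (t ^+ 2)) ?exprn_gt0 //.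
rewrite -[X in _ * X](ger0_norm (sqr_ge0 t)) -normrM.
move: ha hb; move: (inner (u *m _) v) (inner (v *m _) u) => a b.
move: (f _) (f _) (f _) (f _) => f1 f2 f3 f4.
by rewrite !ler_norml; move: (t ^+ 2) => s; clear; lra.
Qed.

End Gradient.

(** * Convex functions with Lipschitz gradient and their Clarke Hessians *)

Section ConvexGradient.
Context {R : realType} {n : nat}.
Implicit Types (f : 'rV[R]_n -> R) (G : 'rV[R]_n -> 'rV[R]_n).

(** G is a Lipschitz selection of (strong) subgradients of f.  The definition
    avoids derivatives: differentiability, grad f = G and the quadratic upper
    bound all follow, and both properties are easy to check for functions
    defined by a supremum. *)
Definition convex_gradient (m K : R) f G : Prop :=
  (forall x y, f x + inner (G x) (y - x) + m * enorm (y - x) ^+ 2 <= f y) /\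
  (forall x y, enorm (G y - G x) <= K * enorm (y - x)).

Variables (m K : R) (f : 'rV[R]_n -> R) (G : 'rV[R]_n -> 'rV[R]_n).
Hypotheses (m_ge0 : 0 <= m) (fG : convex_gradient m K f G).

Lemma convex_gradient_lb x y : f x + inner (G x) (y - x) <= f y.
Proof.
case: fG => [+ _] => /(_ x y); apply: le_trans; rewrite lerDl.
by rewrite mulr_ge0 ?sqr_ge0.
Qed.

(** From the subgradient inequality at y, where the gradient differs from the
    one at x by at most K |y - x|. *)
Lemma convex_gradient_ub x y :
  f y <= f x + inner (G x) (y - x) + K * enorm (y - x) ^+ 2.
Proof.
have := convex_gradient_lb y x.
have := inner_le (G y - G x) (y - x).
have : enorm (G y - G x) * enorm (y - x) <= K * enorm (y - x) * enorm (y - x).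
  by rewrite ler_wpM2r ?enorm_ge0 //; case: fG.
rewrite -mulrA -expr2 -(opprB y x) !innerE.
move: (K * _) (enorm _ * _) => a b; clear; lra.
Qed.

Lemma convex_gradientP x :
  differentiable (f : 'rV[R]_n -> R^o) x /\ grad f x = G x.
Proof.
apply: gradP => e e0; apply: filterS (near0_mul_sqr K e0) => v; apply: le_trans.
have := convex_gradient_lb x (x + v); have := convex_gradient_ub x (x + v).
rewrite [x + v - x]addrAC subrr add0r => ub lb.
by rewrite ger0_norm; lra.
Qed.

Lemma convex_gradient_grad : grad f = G.
Proof. by apply/funext => x; case: (convex_gradientP x). Qed.

Lemma convex_gradient_monotone x y :
  2 * m * enorm (y - x) ^+ 2 <= inner (G y - G x) (y - x).
Proof.
case: fG => fl _; have := fl x y; have := fl y x.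
rewrite (enormB x y) -(opprB y x) !innerE.
move: (enorm _ ^+ 2) (inner (G y) y) (inner (G y) x) (inner (G x) y) => a b c d.
move: (inner (G x) x) (f x) (f y) => ? ? ?; clear; lra.
Qed.

(** The Loewner bounds a <= M <= b for a symmetric M; as a condition on M it is
    closed and convex. *)
Definition sym_bounded (a b : R) (M : 'M[R]_n) : Prop :=
  (forall u v, inner (u *m M) v = inner (v *m M) u) /\
  forall v, a * enorm v ^+ 2 <= inner (v *m M) v <= b * enorm v ^+ 2.

(** Symmetry is that of second derivatives.  The bounds come from comparing
    <G(x + tv) - G(x), tv>, which lies between 2 m |tv|^2 and K |tv|^2, with its
    expansion t^2 <v J, v>. *)
Lemma sym_bounded_jacobian x :
  differentiable G x -> sym_bounded (2 * m) K ('J G x).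
Proof.
move=> dG; split=> [u v|v].
  have dG' : differentiable (grad f) x by rewrite convex_gradient_grad.
  have := jacobian_grad_sym u v (fun y => (convex_gradientP y).1) dG'.
  by rewrite convex_gradient_grad.
have [->|v0] := eqVneq v 0.
  by rewrite mul0mx inner0l enorm0 expr0n !mulr0 lexx.
have nv : 0 < enorm v by rewrite enorm_gt0.
suff H (e : R) : 0 < e -> (2 * m - e) * enorm v ^+ 2 <= inner (v *m 'J G x) v
    <= (K + e) * enorm v ^+ 2.
  have nv2 := exprn_gt0 2 nv.
  apply/andP; split; [rewrite -ler_pdivlMr //|rewrite -ler_pdivrMr //].
    apply/ler_addgt0Pr => e /H/andP[+ _].
    by rewrite -ler_pdivlMr // lerBlDr.
  apply/ler_addgt0Pr => e /H/andP[_ +].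
  by rewrite -ler_pdivrMr.
move=> e0.
have [d d0 Gexp] := (near0_enormP _).1 (jacobian_expansion dG e0).
pose t := d / 2 / enorm v.
have t0 : 0 < t by rewrite !divr_gt0.
have tv : enorm (t *: v) = d / 2.
  by rewrite enormZ gtr0_norm // /t divfK // gt_eqF.
have /Gexp : enorm (t *: v) < d by rewrite tv ltr_pdivrMr // ltr_pMr // ltr1n.
have := convex_gradient_monotone x (x + t *: v).
have := fG.2 x (x + t *: v).
rewrite [x + _ - x]addrAC subrr add0r -scalemxAl enormZ gtr0_norm //.
set D := G _ - G _; move: ('J G x) => J Dlip Dmono Dexp.
have rest : `|inner (D - t *: (v *m J)) (t *: v)| <= e * (t * enorm v) * (t *
  enorm v).
  apply: le_trans (norm_inner_le _ _) _.
  by rewrite enormZ gtr0_norm // ler_wpM2r // mulr_ge0 ?enorm_ge0 // ltW.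
have Dub : inner D (t *: v) <= K * (t * enorm v) * (t * enorm v).
  apply: le_trans (inner_le _ _) _.
  by rewrite enormZ gtr0_norm // ler_wpM2r // mulr_ge0 ?enorm_ge0 // ltW.
have t2 : 0 < t ^+ 2 by rewrite exprn_gt0.
have innerE' : inner (D - t *: (v *m J)) (t *: v)
    = inner D (t *: v) - t ^+ 2 * inner (v *m J) v by rewrite !innerE; ring.
move: rest Dmono Dub; rewrite innerE' ler_norml.
have pull a : a * (t * enorm v) * (t * enorm v) = t ^+ 2 * (a * enorm v ^+ 2).
  by ring.
have pull2 a : a * (t * enorm v) ^+ 2 = t ^+ 2 * (a * enorm v ^+ 2) by ring.
rewrite !pull !pull2 {pull pull2}.
move: t2; move: (inner D _) (t ^+ 2) (inner (v *m _) _) (enorm v ^+ 2) => a s I N s0.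
move=> /andP[lo hi] mono ub; apply/andP; split; rewrite -(ler_pM2l s0).
  by move: lo hi mono ub; clear; lra.
by move: lo hi mono ub; clear; lra.
Qed.

End ConvexGradient.

Section Clarke.
Context {R : realType} {n : nat}.

Lemma sym_bounded_cvg (a b : R) (u : nat -> 'M[R]_n) (M : 'M[R]_n) :
  (forall k, sym_bounded a b (u k)) -> u @ \oo --> M -> sym_bounded a b M.
Proof.
move=> ub uM; split=> [v w|v].
  have hv := cvg_mulmxl v w uM; have := cvg_mulmxl w v uM.
  rewrite (_ : (fun t => _) = (fun t => inner (v *m u t) w)); last first.
    by apply/funext => k; case: (ub k).
  by move=> hw; rewrite -(cvg_lim _ (hv _)) // -(cvg_lim _ (hw _)).
have hv := cvg_mulmxl v v uM; apply/andP; split.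
  rewrite -(cvg_lim _ (hv _)) //; apply: limr_ge; first by apply/cvg_ex;
    exists (inner (v *m M) v); exact: hv.
  by apply: nearW => k; case: (ub k) => _ /(_ v)/andP[].
rewrite -(cvg_lim _ (hv _)) //; apply: limr_le; first by apply/cvg_ex;
  exists (inner (v *m M) v); exact: hv.
by apply: nearW => k; case: (ub k) => _ /(_ v)/andP[].
Qed.

Lemma inner_mulmx_sum k (w : 'I_k -> R) (a : 'I_k -> 'M[R]_n) u v :
  inner (u *m \sum_i w i *: a i) v = \sum_i w i * inner (u *m a i) v.
Proof.
rewrite mulmx_sumr.
elim/big_ind2: _ => [|x1 x2 y1 y2 <- <-|i _]; first by rewrite inner0l.
  by rewrite innerDl.
by rewrite -scalemxAr innerZl.
Qed.

Lemma sym_bounded_hull (a b : R) (A : set 'M[R]_n) (M : 'M[R]_n) :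
  (forall B, A B -> sym_bounded a b B) -> convex_hull A M -> sym_bounded a b M.
Proof.
move=> Ab [k [w [B [w0 w1 AB ->]]]]; split=> [u v|v].
  by rewrite !inner_mulmx_sum; apply: eq_bigr => i _; case: (Ab _ (AB i)) => ->.
rewrite inner_mulmx_sum; apply/andP; split.
  rewrite -[leLHS]mul1r -w1 mulr_suml; apply: ler_sum => i _.
  by rewrite ler_wpM2l //; case: (Ab _ (AB i)) => _ /(_ v)/andP[].
rewrite -[leRHS]mul1r -w1 mulr_suml; apply: ler_sum => i _.
by rewrite ler_wpM2l //; case: (Ab _ (AB i)) => _ /(_ v)/andP[].
Qed.

(** The Clarke Jacobian is the convex hull of limits of Jacobians, and the
    bounds pass to limits and to convex combinations. *)
Lemma sym_bounded_clarke (m K : R) f (G : 'rV[R]_n -> 'rV[R]_n) x M :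
  0 <= m -> convex_gradient m K f G -> clarke G x M -> sym_bounded (2 * m) K M.
Proof.
move=> m0 fG; apply: sym_bounded_hull => B [u [du _ uB]].
by apply: sym_bounded_cvg uB => k; apply: (sym_bounded_jacobian m0 fG).
Qed.

End Clarke.

(** * Existence of minimizers of strongly convex functions *)

Section Minimization.
Context {R : realType} {n : nat}.
Implicit Types (theta : 'rV[R]_n -> \bar R) (x y z w : 'rV[R]_n).

(** Bounded and closed for the max norm. *)
Lemma compact_enorm_ball (z : 'rV[R]_n) (r : R) :
  compact [set w | enorm (w - z) <= r].
Proof.
apply: bounded_closed_compact.
  exists (r + `|z|); split; first exact: num_real.
  move=> M rM w /= wz; apply: ltW; apply: le_lt_trans rM.
  rewrite -[w](subrK z); apply: le_trans (ler_normD _ _) _.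
  by rewrite lerD2r; apply: le_trans wz; exact: norm_le_enorm.
apply: (@preimage_closed _ _ (fun w => enorm (w - z)) [set a | a <= r]).
  by move=> w _; exact: continuous_enormB.
exact: closed_le.
Qed.

Lemma ereal_between (u v : \bar R) : (u < v)%E ->
  exists a : R, (u < a%:E)%E /\ (a%:E < v)%E.
Proof.
case: u v => [r||] [s||] //.
- rewrite lte_fin => rs; exists ((r + s) / 2); rewrite !lte_fin.
  by have [] := midf_lt rs.
- by move=> _; exists (r + 1); rewrite ltry lte_fin ltrDl.
- by move=> _; exists (s - 1); rewrite ltNyr lte_fin ltrBlDr ltrDl.
- by move=> _; exists 0; rewrite ltry ltNyr.
Qed.

(** If the infimum were not attained, the open sets where theta exceeds a
    level a above the infimum would cover K; a finite subcover gives a single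
    such level below theta on K. *)
Lemma lsc_min_compact theta (K : set 'rV[R]_n) z0 :
  lower_semicontinuous theta -> compact K -> K z0 -> theta z0 != +oo%E ->
  exists2 z, K z & forall w, K w -> (theta z <= theta w)%E.
Proof.
move=> lsc cK Kz0 z0fin; apply: contrapT => nomin.
pose i := ereal_inf (theta @` K).
have i_lt w : K w -> (i < theta w)%E.
  move=> Kw; rewrite lt_neqAle; apply/andP; split; last first.
    by apply: ereal_inf_lbound; exists w.
  apply/eqP => iw; apply: nomin; exists w => // w' Kw'.
  by rewrite -iw; apply: ereal_inf_lbound; exists w'.
pose D := [set a : R | (i < a%:E)%E].
pose U (a : R) := [set w | (a%:E < theta w)%E].
have Uopen a : D a -> open (U a) by move=> _; exact: (lower_semicontinuousP _).1.
have KU : K `<=` cover D U.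
  by move=> w Kw; have [a [ia aw]] := ereal_between (i_lt w Kw); exists a.
have := cK; rewrite compact_cover => /(_ _ _ _ Uopen KU)[D' D'D KU'].
(* the smallest of the finitely many levels is a lower bound of theta on K
   above its infimum *)
have [a0 a0D' a0z] := KU' _ Kz0.
pose a := \big[Num.min/a0]_(a <- finmap.enum_fset D') a.
have aD : (i < a%:E)%E.
  rewrite /a big_seq; elim/big_ind: _ => [|b c ib ic|b bD'].
  - by have := D'D _ a0D'; rewrite inE.
  - by rewrite minEle; case: ifP.
  - by have := D'D _ bD'; rewrite inE.
have : (a%:E <= i)%E.
  apply: le_ereal_inf_tmp => _ [w Kw <-].
  have [b bD' bw] := KU' _ Kw; apply: ltW; apply: le_lt_trans bw.
  by rewrite lee_fin; apply: (bigmin_inf_seq _ b).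
by rewrite leNgt aD.
Qed.

(** Strong convexity of an extended-valued function, stated at points of its
    effective domain so that no arithmetic with infinite values occurs. *)
Definition estrongly_convex (mu : R) theta : Prop :=
  forall x y (a b t : R), theta x = a%:E -> theta y = b%:E -> 0 < t < 1 ->
    (theta (t *: x + (1 - t) *: y)%R <=
     (t * a + (1 - t) * b - mu / 2 * t * (1 - t) * enorm (x - y) ^+ 2)%:E)%E.

(** Compare the value at a minimizer z with the value at the midpoint of z
    and w. *)
Lemma strongly_convex_growth mu theta z w (a b : R) :
  estrongly_convex mu theta -> (forall w, (theta z <= theta w)%E) ->
  theta z = a%:E -> theta w = b%:E -> a + mu / 4 * enorm (w - z) ^+ 2 <= b.
Proof.
move=> sc zmin za wb.
have half01 : 0 < (2^-1 : R) < 1 by rewrite invr_gt0 ltr0n invf_lt1 ?ltr1n.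
have := le_trans (zmin _) (sc _ _ _ _ _ wb za half01).
rewrite za lee_fin; move: (enorm _ ^+ 2) => e; clear; lra.
Qed.

(** Let m1 be the minimum of theta on the unit ball around a point z0 of the
    domain.  Convexity along the segment from z0 to a point w at distance r,
    evaluated where it leaves the unit ball, gives
    theta(w) - theta(z0) >= r (m1 - theta(z0) + mu (r - 1) / 2), so that theta
    exceeds theta(z0) outside the ball of radius r0 and its minimum on that
    ball is global. *)
Lemma strongly_convex_min mu theta : 0 < mu -> lower_semicontinuous theta ->
  (forall x, theta x != -oo%E) -> estrongly_convex mu theta -> dom theta !=set0 ->
  exists z (a : R), theta z = a%:E /\ forall w, (theta z <= theta w)%E.
Proof.
move=> mu0 lsc noNy sc [z0 z0dom].
have [c z0c] : exists c, theta z0 = c%:E.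
  move: z0dom (noNy z0); rewrite /dom /=.
  by case: (theta z0) => // c _ _; exists c.
have z0fin : theta z0 != +oo%E by rewrite z0c.
have ball0 r : 0 <= r -> [set w | enorm (w - z0) <= r] z0.
  by rewrite /= subrr enorm0.
have [z1 _ z1min] := lsc_min_compact lsc (@compact_enorm_ball z0 1) (ball0 _
  ler01) z0fin.
have [m1 z1m] : exists m, theta z1 = m%:E.
  have := z1min _ (ball0 _ ler01); rewrite z0c; move: (noNy z1).
  by case: (theta z1) => // m _ _; exists m.
have m1c : m1 <= c by rewrite -lee_fin -z1m -z0c; exact: z1min (ball0 _ ler01).
pose r0 := 1 + 2 * (c - m1) / mu.
have r0_ge1 : 1 <= r0.
  by rewrite lerDl mulr_ge0 ?invr_ge0 ?(ltW mu0) // mulr_ge0 // subr_ge0.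
have r0_ge0 : 0 <= r0 := le_trans ler01 r0_ge1.
have [z _ zmin] := lsc_min_compact lsc (@compact_enorm_ball z0 r0) (ball0 _
  r0_ge0) z0fin.
have zc : (theta z <= c%:E)%E by rewrite -z0c; exact: zmin (ball0 _ r0_ge0).
have [a za] : exists a, theta z = a%:E.
  by move: zc (noNy z); case: (theta z) => // a _ _; exists a.
exists z, a; split=> // w.
have [wr|rw] := leP (enorm (w - z0)) r0; first exact: zmin.
apply: le_trans zc _; case wb: (theta w) => [b||]; first 1 last.
- exact: leey.
- by move: (noNy w); rewrite wb.
set r := enorm (w - z0) in rw.
have r1 : 1 < r by apply: le_lt_trans rw.
have r_gt0 : 0 < r by apply: lt_trans r1.
have t01 : 0 < r^-1 < 1 by rewrite invr_gt0 r_gt0 invf_lt1.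
have := sc _ _ _ _ _ wb z0c t01.
have -> : r^-1 *: w + (1 - r^-1) *: z0 = z0 + r^-1 *: (w - z0).
  by rewrite scalerBl scale1r scalerBr addrCA addrA.
have u_ball : [set w | enorm (w - z0) <= 1] (z0 + r^-1 *: (w - z0)).
  rewrite /= addrAC subrr add0r enormZ gtr0_norm ?invr_gt0 //.
  by rewrite mulVf // gt_eqF.
move=> /(le_trans (z1min _ u_ball)); rewrite z1m lee_fin -/r.
have -> : mu / 2 * r^-1 * (1 - r^-1) * r ^+ 2 = mu / 2 * (r - 1).
  by field; rewrite gt_eqF.
move=> m1_le; rewrite lee_fin -subr_ge0.
rewrite -(pmulr_rge0 _ (_ : 0 < r^-1)) ?invr_gt0 //.
have : c - m1 <= mu / 2 * (r - 1).
  have : 2 * (c - m1) / mu <= r - 1 by rewrite lerBrDl ltW.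
  by rewrite ler_pdivrMr //; clear; lra.
by move: m1_le; move: (r^-1) (mu / 2 * _) => s e; clear; lra.
Qed.

End Minimization.

(** * Conjugates of strongly convex smooth functions *)

Section Conjugate.
Context {R : realType} {n : nat}.
Implicit Types (x y z w xi : 'rV[R]_n).

Lemma continuous_lsc (f : 'rV[R]_n -> R) :
  continuous f -> lower_semicontinuous (fun x => (f x)%:E).
Proof.
move=> cf x a; rewrite lte_fin => afx.
exists [set y | a < f y]; last by move=> y; rewrite lte_fin.
exact: (cvgr_gt (f x) (cf x)).
Qed.

Variables (p : 'rV[R]_n -> R) (mu L : R).
Hypotheses (mu_gt0 : 0 < mu) (L_gt0 : 0 < L) (p_sc : strongly_convex mu p)
  (p_diff : forall x, differentiable (p : 'rV[R]_n -> R^o) x)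
  (p_lip : forall x y, enorm (grad p y - grad p x) <= L * enorm (y - x)).

(** w |-> p(w) - <xi, w> is strongly convex, so it has a minimizer, with
    quadratic growth around it. *)
Lemma conj_argmax xi : exists z, forall w,
  p z + inner xi (w - z) + mu / 4 * enorm (w - z) ^+ 2 <= p w.
Proof.
pose theta w := (p w - inner xi w)%:E.
have sc : estrongly_convex mu theta.
  move=> x y _ _ t [<-] [<-] /andP[t0 t1]; rewrite lee_fin.
  have := @p_sc x y t; rewrite (ltW t0) (ltW t1) => /(_ isT).
  rewrite !innerE; move: (p _) (p x) (p y) (inner xi x) (inner xi y) => a b c d e.
  by move: (mu / 2 * _ * _ * _) => f; lra.
have lsc : lower_semicontinuous theta.
  apply: continuous_lsc => x; apply: (@cvgB _ _ _ (nbhs x)).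
    exact: (differentiable_continuous (p_diff x)).
  by apply: (@cvg_inner _ _ _ (nbhs x) _ (cst xi) id); [exact: cvg_cst|exact: cvg_id].
have [||z [a [za zmin]]] := @strongly_convex_min _ _ mu theta mu_gt0 lsc _ sc.
- by [].
- by exists 0; rewrite /dom /= ltry.
exists z => w; have := strongly_convex_growth sc zmin za (erefl (theta w)).
by case: za => <-; rewrite !innerE; lra.
Qed.

Let G xi := projT1 (cid (conj_argmax xi)).
Let c xi := inner xi (G xi) - p (G xi).

Let GP xi w : p (G xi) + inner xi (w - G xi) + mu / 4 * enorm (w - G xi) ^+ 2 <= p w.
Proof. by rewrite /G; case: cid. Qed.

Let mu4_ge0 : 0 <= mu / 4. Proof. by rewrite divr_ge0 // ltW. Qed.

Let c_ge xi w : inner xi w - p w <= c xi.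
Proof.
have := GP xi w; rewrite /c innerDr innerNr.
have := mulr_ge0 mu4_ge0 (sqr_ge0 (enorm (w - G xi))).
by move: (mu / 4 * _) => e; lra.
Qed.

(** G xi maximizes <xi, .> - p; if h = xi - grad p (G xi) were nonzero, a small
    step along h would increase the objective. *)
Let grad_G xi : grad p (G xi) = xi.
Proof.
apply/eqP; rewrite -subr_eq0; apply/eqP/enorm_eq0/eqP.
apply: contraT => h0.
rewrite -opprB enormN in h0; set h := xi - _ in h0.
have {h0}hn : 0 < enorm h by rewrite lt_neqAle eq_sym h0 enorm_ge0.
have [d d0 dP] := (near0_enormP _).1 (grad_expansion (p_diff (G xi)) (divr_gt0 hn
  (ltr0n _ 2))).
pose t := d / 2 / enorm h.
have t0 : 0 < t by rewrite !divr_gt0.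
have tv : enorm (t *: h) = d / 2.
  by rewrite enormZ gtr0_norm // /t divfK // gt_eqF.
have /dP : enorm (t *: h) < d by rewrite tv ltr_pdivrMr // ltr_pMr // ltr1n.
have := c_ge xi (G xi + t *: h); rewrite /c tv.
have : inner h (t *: h) = enorm h * (d / 2).
  by rewrite innerZr -sqr_enorm -tv enormZ gtr0_norm // expr2; ring.
rewrite {1}/h; move: (t *: h) => v; rewrite !innerE => hv cge.
move=> /ler_normlP[_]; have := mulr_gt0 hn d0.
move: hv cge; move: (inner xi _) (p _) (p (_ + v)) (inner _ v) (inner xi v) => a1
  a2 a3 a4 a5.
by move: (enorm h) => e; lra.
Qed.

Let p_ub xi w : p w <= p (G xi) + inner xi (w - G xi) + L * enorm (w - G xi) ^+ 2.
Proof.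
have [t /andP[t0 t1]] := grad_MVT (G xi) (w - G xi) p_diff.
rewrite subrKC => pE; set v := w - _ in pE *.
have : inner (grad p (G xi + t *: v) - grad p (G xi)) v <= L * enorm v ^+ 2.
  apply: le_trans (inner_le _ _) _; rewrite expr2 mulrA ler_wpM2r ?enorm_ge0 //.
  apply: le_trans (p_lip _ _) _; rewrite addrAC subrr add0r ler_pM2l //.
  by rewrite enormZ gtr0_norm // ler_piMl ?enorm_ge0 // ltW.
move: pE; rewrite innerDl innerNl grad_G.
by move: (inner _ v) (L * _) => a b; lra.
Qed.

(** The subgradient inequality of the conjugate is that of a supremum of affine
    functions; its strong form uses the quadratic upper bound of p.  The
    Lipschitz bound of the argmax map is that of its quadratic growth, applied
    at xi and at xi'. *)
Let c_grad : convex_gradient (4 * L)^-1 (2 / mu) c G.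
Proof.
split=> xi xi'; last first.
  have := GP xi (G xi'); have := GP xi' (G xi).
  rewrite (enormB (G xi)) -(opprB (G xi') (G xi)) innerNr.
  set D := G xi' - G xi => h1 h2.
  have {h1 h2} mono : mu / 2 * enorm D ^+ 2 <= inner (xi' - xi) D.
    move: h1 h2; rewrite innerDl innerNl.
    by move: (enorm _ ^+ 2) (inner _ D) (inner _ D) (p _) (p _) => *; lra.
  have := le_trans mono (inner_le _ _).
  have [->|D0] := eqVneq (enorm D) 0.
    by rewrite mulr_ge0 ?enorm_ge0 // divr_ge0 // ltW.
  have Dn : 0 < enorm D by rewrite lt_neqAle eq_sym D0 enorm_ge0.
  rewrite expr2 mulrA ler_pM2r // => h.
  by rewrite mulrAC ler_pdivlMr //; move: h; move: (enorm _) (enorm _) => *; lra.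
(* the test point is the maximizer for xi moved along xi' - xi by the step
   that is optimal for the quadratic upper bound *)
pose s := (2 * L)^-1.
have := c_ge xi' (G xi + s *: (xi' - xi)).
have := p_ub xi (G xi + s *: (xi' - xi)).
rewrite [_ + _ - G xi]addrAC subrr add0r !innerE.
have -> : enorm (s *: (xi' - xi)) ^+ 2 = s ^+ 2 * enorm (xi' - xi) ^+ 2.
  by rewrite enormZ exprMn real_normK ?num_real.
rewrite -(sqr_enorm xi) -(sqr_enorm xi').
have -> : enorm (xi' - xi) ^+ 2 = enorm xi' ^+ 2 - 2 * inner xi xi' + enorm xi ^+ 2.
  by rewrite !sqr_enorm !innerE (innerC xi' xi); ring.
rewrite /c (innerC xi' xi) (innerC (G xi) xi') (innerC (G xi) xi).
have -> : L * (s ^+ 2 * (enorm xi' ^+ 2 - 2 * inner xi xi' + enorm xi ^+ 2))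
  = (4 * L)^-1 * (enorm xi' ^+ 2 - 2 * inner xi xi' + enorm xi ^+ 2).
  by rewrite /s; field; rewrite gt_eqF.
have -> : s = 2 * (4 * L)^-1 by rewrite /s; field; rewrite gt_eqF.
move: (p _) (p _) (c xi') (inner _ _) (inner _ _) (inner _ _) => a1 a2 a3 a4 a5 a6.
move: (enorm _ ^+ 2) (enorm _ ^+ 2) (4 * L)^-1 => b1 b2 b3.
by lra.
Qed.

Lemma conj_fin xi : conj p xi = (c xi)%:E.
Proof.
apply/eqP; rewrite eq_le; apply/andP; split.
  by apply: ge_ereal_sup => _ [w _ <-]; rewrite lee_fin.
by apply: ereal_sup_ubound; exists (G xi).
Qed.

Lemma fine_conj : fine \o conj p = c.
Proof. by apply/funext => xi /=; rewrite conj_fin. Qed.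

Lemma convex_gradient_conj :
  convex_gradient (4 * L)^-1 (2 / mu) (fine \o conj p) (grad_conj p).
Proof.
have m0 : 0 <= (4 * L)^-1 by rewrite invr_ge0 mulr_ge0 // ltW.
by rewrite /grad_conj fine_conj (convex_gradient_grad m0 c_grad).
Qed.

Lemma intdom_conjT xi : intdom_conj p xi.
Proof.
apply: filterS (filterT : nbhs xi setT) => xi' _.
by rewrite /dom /= conj_fin ltry.
Qed.

End Conjugate.

(** * Proximal maps and Moreau envelopes *)

Section Prox.
Context {R : realType} {n : nat}.
Implicit Types (x y z w : 'rV[R]_n) (theta : 'rV[R]_n -> \bar R).

Lemma lscD_continuous theta (q : 'rV[R]_n -> R) :
  lower_semicontinuous theta -> (forall x, theta x != -oo%E) -> continuous q ->
  lower_semicontinuous (fun w => (theta w + (q w)%:E)%E).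
Proof.
move=> lsc noNy cq x a; rewrite -lteBlDr // -EFinB => /ereal_between[b [ab bx]].
have [V Vx VP] := lsc _ _ bx.
have qx : \forall y \near x, a - b < q y.
  apply: (cvgr_gt (q x) (cq x)); move: ab; rewrite lte_fin; lra.
exists (V `&` [set y | a - b < q y]); first exact: filterI.
move=> y [/VP by_ qy]; rewrite -lteBlDr // -EFinB.
apply: le_lt_trans by_; rewrite lee_fin; move: qy => /=; lra.
Qed.

Lemma continuous_sqr_enormB x : continuous (fun w : 'rV[R]_n => 2^-1 * enorm (x -
  w) ^+ 2).
Proof.
move=> w; apply: (@cvgMl_tmp _ _ (nbhs w)).
rewrite (_ : (fun _ => _) = (fun w => enorm (w - x) * enorm (w - x))).
  rewrite expr2 enormB.
  by apply: (@cvgM _ _ (nbhs w)); exact: continuous_enormB.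
by apply/funext => v; rewrite expr2 enormB.
Qed.

Variable theta : 'rV[R]_n -> \bar R.
Hypothesis theta_ccp : closed_convex_proper theta.

Let reg x w := (theta w + (2^-1 * enorm (x - w) ^+ 2)%:E)%E.

Let reg_fin x w b : reg x w = b%:E -> theta w = (b - 2^-1 * enorm (x - w) ^+ 2)%:E.
Proof.
rewrite /reg; case: (theta w) => [a||] //= [<-].
by rewrite addrK.
Qed.

Let reg_sc x : estrongly_convex 1 (reg x).
Proof.
case: theta_ccp => _ cvx _ _ y z a b t /reg_fin ya /reg_fin zb t01.
have := cvx y z t t01; rewrite ya zb => h.
apply: le_trans (leeD2r _ h) _.
rewrite -!EFinM -!EFinD lee_fin.
have -> : x - (t *: y + (1 - t) *: z) = t *: (x - y) + (1 - t) *: (x - z).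
  by rewrite !scalerBr addrACA -scalerDl subrKC scale1r opprD.
have -> : y - z = (x - z) - (x - y) by rewrite opprB [RHS]addrC addrA subrK.
move: (x - y) (x - z) => u v; rewrite !sqr_enorm !innerE (innerC v u).
move: (inner u u) (inner u v) (inner v v) => i1 i2 i3.
by rewrite le_eqVlt; apply/orP; left; apply/eqP; field.
Qed.

Let prox_min x : exists a : R, reg x (prox theta x) = a%:E /\
  forall w, (reg x (prox theta x) <= reg x w)%E.
Proof.
have [lsc _ noNy [z0 z0dom]] := theta_ccp.
have [||z [a [za zmin]]] := strongly_convex_min ltr01
  (lscD_continuous lsc noNy (@continuous_sqr_enormB x)) _ (@reg_sc x).
- by move=> w; move: (noNy w); case: (theta w).
- exists z0; move: z0dom (noNy z0); rewrite /dom /=.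
  by case: (theta z0) => [r||] //= _ _; exact: ltry.
have pmin : forall w, (reg x (prox theta x) <= reg x w)%E.
  by rewrite /prox; apply: (@getPex _ [set z | forall w, (reg x z <= reg x
    w)%E]); exists z.
have [b pE] : exists b, theta (prox theta x) = b%:E.
  have := pmin z; rewrite [reg x z]za /reg; have := noNy (prox theta x).
  by case: (theta _) => [b||] // _ _; exists b.
exists (b + 2^-1 * enorm (x - prox theta x) ^+ 2); split=> //.
by rewrite /reg pE.
Qed.

Let val x := fine (theta (prox theta x)).

Let valE x : theta (prox theta x) = (val x)%:E.
Proof. by have [a [/reg_fin pa _]] := prox_min x; rewrite /val pa. Qed.

Let env_fin x : env theta x = (val x + 2^-1 * enorm (x - prox theta x) ^+ 2)%:E.
Proof.
have [a [_ pmin]] := prox_min x.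
have -> : (val x + 2^-1 * enorm (x - prox theta x) ^+ 2)%:E = reg x (prox theta x).
  by rewrite /reg valE.
apply/eqP; rewrite eq_le; apply/andP; split.
  by apply: ereal_inf_lbound; exists (prox theta x).
by apply: le_ereal_inf_tmp => _ [w _ <-]; exact: pmin.
Qed.

Let fine_env x : fine (env theta x) = val x + 2^-1 * enorm (x - prox theta x) ^+ 2.
Proof. by rewrite env_fin. Qed.

Let growth x y : val x + 2^-1 * enorm (x - prox theta x) ^+ 2
    + 4^-1 * enorm (prox theta y - prox theta x) ^+ 2
  <= val y + 2^-1 * enorm (x - prox theta y) ^+ 2.
Proof.
have [a [pa pmin]] := prox_min x.
rewrite -[4^-1]mul1r.
apply: (strongly_convex_growth (@reg_sc x) pmin); first by rewrite /reg valE.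
by rewrite /reg valE.
Qed.

(** |x|^2 / 2 - env(x) is the supremum over z of <x, z> - |z|^2 / 2 - theta(z),
    attained at prox(x): it is the conjugate of the strongly convex function
    theta + |.|^2 / 2, and prox is its argmax map. *)
Lemma convex_gradient_env :
  convex_gradient 0 2 (fun x => 2^-1 * enorm x ^+ 2 - fine (env theta x))
    (prox theta).
Proof.
split=> x y.
  have := growth y x.
  rewrite (fine_env x) (fine_env y) mul0r addr0.
  move: (prox theta x) (prox theta y) (val x) (val y) => px py a b.
  rewrite !sqr_enorm.
  have := inner_ge0 (px - py).
  rewrite !innerE ?(innerC px x) ?(innerC px y) ?(innerC py y) ?(innerC y x)
    ?(innerC py px) ?(innerC py x).
  move: (inner px px) (inner py py) (inner px py) (inner x px) (inner y px) => ?
    ? ? ? ?.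
  move: (inner y py) (inner x x) (inner y y) => ? ? ?.
  lra.
have := growth x y; have := growth y x.
move: (prox theta x) (prox theta y) (val x) (val y) => px py a b.
rewrite (enormB px py) => h1 h2.
have : 2^-1 * enorm (py - px) ^+ 2 <= inner (y - x) (py - px).
  move: h1 h2; move: (enorm (py - px) ^+ 2) => N.
  rewrite !sqr_enorm !innerE ?(innerC px x) ?(innerC px y) ?(innerC py x)
    ?(innerC py y).
  move: (inner px px) (inner py py) (inner x px) (inner y px) => ? ? ? ?.
  move: (inner y py) (inner x py) (inner x x) (inner y y) => ? ? ? ?.
  lra.
move=> /le_trans /(_ (inner_le _ _)).
have [->|D0] := eqVneq (enorm (py - px)) 0.
  by rewrite mulr_ge0 ?enorm_ge0.
have Dn : 0 < enorm (py - px) by rewrite lt_neqAle eq_sym D0 enorm_ge0.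
rewrite expr2 mulrA ler_pM2r //; move: (enorm _) (enorm _) => *; lra.
Qed.

End Prox.

Lemma closed_convex_proper_scale (R : realType) n (alpha : R)
    (phi : 'rV[R]_n -> \bar R) :
  0 < alpha -> closed_convex_proper phi -> closed_convex_proper (escale alpha phi).
Proof.
move=> a0 [lsc cvx noNy [x0 x0dom]]; split.
- move=> x a; rewrite /escale muleC -lte_pdivrMr // => h.
  have [V Vx VP] := lsc x (a / alpha) h.
  by exists V => // y /VP; rewrite muleC -lte_pdivrMr.
- move=> x y t t01; rewrite /escale.
  apply: le_trans (lee_wpmul2l _ (cvx x y t t01)) _; first by rewrite lee_fin ltW.
  have scaledN u (s : R) : 0 < s -> (s%:E * phi u)%E \in [pred v | (-oo < v)%E].
    move=> s0; rewrite inE /=; move: (noNy u); case: (phi u) => [r||] // _.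
      by rewrite -EFinM ltNyr.
    by rewrite mulry gtr0_sg // mul1e.
  case/andP: t01 => t0 t1; rewrite muleDr //.
    by rewrite !muleA !(muleC alpha%:E).
  by apply: ltninfty_adde_def; apply: scaledN; rewrite // subr_gt0.
- move=> x; rewrite /escale; move: (noNy x); case: (phi x) => //.
  by rewrite mulry gtr0_sg // mul1e.
- exists x0; move: x0dom (noNy x0); rewrite /dom /escale /=; case: (phi x0) => //.
  by move=> r _ _; rewrite -EFinM ltry.
Qed.

(** * Conjugate gradient directions *)

Section ConjugateGradient.
Context {R : realType} {d : nat}.
Implicit Types (u r s v : 'rV[R]_d).

Lemma sym_bounded_le (a b : R) (M : 'M[R]_d) v :
  sym_bounded a b M -> a * enorm v <= enorm (v *m M).
Proof.
move=> [_ /(_ v)/andP[+ _]] => /le_trans /(_ (inner_le _ _)).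
have [->|v0] := eqVneq (enorm v) 0.
  by move=> _; rewrite mulr0 enorm_ge0.
have vn : 0 < enorm v by rewrite lt_neqAle eq_sym v0 enorm_ge0.
by rewrite expr2 mulrA ler_pM2r.
Qed.

Lemma sym_bounded_shift (a b eta : R) (M : 'M[R]_d) :
  0 <= eta <= 1 -> sym_bounded a b M -> sym_bounded a (b + 1) (M + eta%:M).
Proof.
move=> /andP[eta0 eta1] [symM bM]; split=> [u v|v].
  by rewrite !mulmxDr !innerDl symM !mul_mx_scalar !innerZl (innerC u).
rewrite mulmxDr innerDl mul_mx_scalar innerZl -sqr_enorm.
have /andP[lo hi] := bM v; have v0 := sqr_ge0 (enorm v).
have e0 := mulr_ge0 eta0 v0; have e1 := ler_wpM2r v0 eta1.
by rewrite mulrDl; apply/andP; split; lra.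
Qed.

Variables (a b : R) (M : 'M[R]_d) (rhs : 'rV[R]_d).
Hypotheses (a_gt0 : 0 < a) (b_gt0 : 0 < b) (Mab : sym_bounded a b M).

Let energy u := 2^-1 * inner (u *m M) u - inner rhs u.

Let curvature_ge0 s : 0 <= inner s (s *m M).
Proof.
rewrite innerC; have [_ /(_ s)/andP[+ _]] := Mab; apply: le_trans.
by rewrite mulr_ge0 ?sqr_ge0 // ltW.
Qed.

Let cg_inv (st : 'rV[R]_d * 'rV[R]_d * 'rV[R]_d) : Prop :=
  st.1.2 = rhs - st.1.1 *m M /\ inner st.1.2 st.2 = inner st.1.2 st.1.2.

(** Two local identities, residual r = rhs - u M and <r, s> = <r, r>, make each
    step an exact line search for the energy; they take the place of the
    conjugacy relations between all search directions.  If the search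
    direction s vanishes then so does r, and the step, whose coefficients are
    then 0 / 0 = 0, is stationary. *)
Let cg_stepP st : cg_inv st -> cg_inv (cg_step M st) /\
  energy (cg_step M st).1.1 =
    energy st.1.1 - 2^-1 * (inner st.1.2 st.1.2 ^+ 2 / inner st.2 (st.2 *m M)).
Proof.
case: st => [[u r] s]; rewrite /cg_inv /cg_step /= => -[rE rs].
set c := inner s (s *m M); set t := inner r r / c; set r' := r - _.
have tc : t * c = inner r r.
  have [c0|c0] := eqVneq c 0; last by rewrite divfK.
  suff s0 : s = 0 by rewrite -rs s0 inner0r /t -rs s0 inner0r !mul0r.
  apply/enorm_eq0/eqP; rewrite -sqrf_eq0 -(mulrI_eq0 _ (lregP (lt0r_neq0 a_gt0))).
  rewrite eq_le mulr_ge0 ?sqr_ge0 ?(ltW a_gt0) // andbT -c0 /c innerC.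
  by have [_ /(_ s)/andP[]] := Mab.
have r's : inner r' s = 0.
  by rewrite /r' innerDl innerNl innerZl (innerC (s *m M) s) -/c tc rs subrr.
split; first split.
- by rewrite /r' rE mulmxDl opprD addrA scalemxAl.
- by rewrite innerDr innerZr r's mulr0 addr0.
have -> : inner r r ^+ 2 / c = t * inner r r by rewrite /t expr2 mulrAC.
rewrite /energy mulmxDl !innerE -scalemxAl !innerZl.
have [symM _] := Mab; rewrite (symM s u) (innerC (s *m M) s) -/c.
have -> : inner rhs s = inner r r + inner (u *m M) s.
  by rewrite -rs rE innerDl innerNl subrK.
rewrite -tc; move: (inner _ _) (inner _ _) (inner _ _) => ? ? ?.
by field.
Qed.

(** The first iterate already has energy at most - |rhs|^2 / (2b) and later
    ones have no larger energy; the quadratic part of the energy is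
    nonnegative. *)
Lemma cg_descent k : (0 < k)%N ->
  enorm rhs ^+ 2 / (2 * b) <= inner rhs (cg_iterate M rhs k).
Proof.
case: k => // k _.
suff [_ en] : cg_inv (iter k.+1 (cg_step M) (0, rhs, rhs)) /\
    energy (cg_iterate M rhs k.+1) <= - (enorm rhs ^+ 2 / (2 * b)).
  have := curvature_ge0 (cg_iterate M rhs k.+1); rewrite innerC.
  move: en; rewrite /energy.
  move: (inner _ _) (inner _ _) (_ / _) => *; lra.
have inv0 : cg_inv (0, rhs, rhs) by rewrite /cg_inv /= mul0mx subr0.
elim: k => [|k [invk enk]].
  have [inv1 en1] := cg_stepP inv0; split=> //.
  rewrite [energy _]en1 /= /energy mul0mx inner0l inner0r mulr0 subrr sub0r.
  rewrite lerN2 invfM mulrCA ler_pM2l ?invr_gt0 //.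
  have [->|rhs0] := eqVneq rhs 0; first by rewrite enorm0 inner0l expr0n !mul0r.
  rewrite -sqr_enorm innerC; have rn : 0 < enorm rhs by rewrite enorm_gt0.
  have [_ /(_ rhs)/andP[lo hi]] := Mab.
  have c0 : 0 < inner (rhs *m M) rhs.
    by apply: lt_le_trans lo; rewrite mulr_gt0 // exprn_gt0.
  rewrite ler_pdivlMr // mulrAC ler_pdivrMr //.
  rewrite [(_ ^+ 2) ^+ 2]expr2 -[leRHS]mulrA; apply: ler_wpM2l; first exact: sqr_ge0.
  by rewrite mulrC.
have [invS enS] := cg_stepP invk; split=> //.
apply: le_trans enk; rewrite /cg_iterate iterS enS lerBlDr lerDl.
by rewrite mulr_ge0 // divr_ge0 // sqr_ge0.
Qed.

End ConjugateGradient.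

(** * Consequences of directional differentiability *)

Section DirectionalDerivative.
Context {R : realType} {d p : nat}.

Lemma near_right0 (P : R -> Prop) : (\forall r \near (0 : R)^'+, P r) ->
  exists2 e : R, 0 < e & forall r, 0 < r < e -> P r.
Proof.
rewrite near_withinE => /nbhs_ballP[e /= e0 eP]; exists e => // r /andP[r0 re].
by apply: eP => //; rewrite -ball_normE /= sub0r normrN gtr0_norm.
Qed.

(** Along each direction the difference quotients are Cauchy as the step tends
    to 0; since they are Lipschitz in the direction, uniformly in the step,
    compactness of the unit ball makes the Cauchy property uniform. *)
Lemma directional_uniform (F : 'rV[R]_d -> 'rV[R]_p) (K : R) xhat :
  0 < K -> (forall x y, enorm (F y - F x) <= K * enorm (y - x)) ->
  directionally_differentiable F xhat -> forall e : R, 0 < e ->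
  \forall s \near (0 : 'rV[R]_d), forall t, 0 <= t <= 1 ->
    enorm (F (xhat + t *: s) - F xhat - t *: (F (xhat + s) - F xhat)) <= e * enorm s.
Proof.
move=> K0 Flip ddF e e0.
pose Q (r : R) u := r^-1 *: (F (xhat + r *: u) - F xhat).
pose P (del : R) u := forall r r', 0 < r < del -> 0 < r' < del ->
  enorm (Q r u - Q r' u) <= e.
have Qlip r u v : 0 < r -> enorm (Q r u - Q r v) <= K * enorm (u - v).
  move=> r0; rewrite /Q -scalerBr opprB addrA subrK.
  rewrite enormZ gtr0_norm ?invr_gt0 // ler_pdivrMl //.
  apply: le_trans (Flip _ _) _; rewrite opprD addrA [xhat + _ - xhat]addrAC subrr
    add0r.
  by rewrite -scalerBr enormZ gtr0_norm // mulrCA.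
have cover u : [set w : 'rV[R]_d | enorm (w - 0) <= 1] u ->
    \forall u' \near u & del \near (0 : R)^'+, P del u'.
  move=> _; have /cvg_ex[/= l /cvg_enormP/cvgrPdist_lt] := ddF u.
  have e4 : 0 < e / 4 by rewrite divr_gt0.
  move=> /(_ _ e4)/near_right0[del del0 delP].
  (* each quotient contributes e / 4 for its distance to the limit along u and
     e / 4 for moving u to u' *)
  exists ([set u' | enorm (u' - u) < e / 4 / K], [set r : R | r < del]).
    split; last exact: nbhs_right_lt.
    by apply/near_enormP; exists (e / 4 / K); rewrite ?divr_gt0.
  move=> [u' r1] /= [u'u r1del] r r' /andP[r0 rr1] /andP[r'0 r'r1].
  have rdel : 0 < r < del by rewrite r0 (lt_trans rr1).
  have r'del : 0 < r' < del by rewrite r'0 (lt_trans r'r1).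
  have := delP _ rdel; have := delP _ r'del.
  rewrite !sub0r !normrN !(ger0_norm (enorm_ge0 _)) -/(Q r u) -/(Q r' u) => h1 h2.
  have h3 := Qlip r u' u r0; have h4 := Qlip r' u u' r'0.
  have h5 : K * enorm (u' - u) < e / 4 by rewrite mulrC -ltr_pdivlMr.
  have -> : Q r u' - Q r' u' = (Q r u' - Q r u) + (Q r u - l)
     - (Q r' u - l) + (Q r' u - Q r' u').
    by rewrite opprB -!addrA !addKr.
  apply: le_trans (enormD _ _) _.
  apply: le_trans (lerD (enormBD _ _) (lexx _)) _.
  apply: le_trans (lerD (lerD (enormD _ _) (lexx _)) (lexx _)) _.
  move: h1 h2 h3 h4 h5; rewrite (enormB u u').
  by move: (enorm _) (enorm _) (enorm _) (enorm _) (K * _) => *; lra.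
have Pball : \forall del \near (0 : R)^'+, [set w | enorm (w - 0) <= 1] `<=` P del.
  exact: ((compact_near_coveringP _).1 (@compact_enorm_ball R d 0 1)).
have [del0 del0_gt0 /(_ (del0 / 2))] := near_right0 Pball.
have del_gt0 : 0 < del0 / 2 by rewrite divr_gt0.
rewrite del_gt0 ltr_pdivrMr // ltr_pMr // ltr1n => /(_ isT) Pdel.
set del := del0 / 2 in del_gt0 Pdel.
apply/near0_enormP; exists del => // s sdel t /andP[t0 t1].
have [s0|s0] := eqVneq (enorm s) 0.
  by rewrite (enorm_eq0 s0) scaler0 addr0 subrr scaler0 subr0 !enorm0 mulr0.
have sn : 0 < enorm s by rewrite lt_neqAle eq_sym s0 enorm_ge0.
have [->|tn] := eqVneq t 0.
  by rewrite !scale0r addr0 subrr subr0 enorm0 mulr_ge0 ?enorm_ge0 // ltW.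
have tp : 0 < t by rewrite lt_neqAle eq_sym tn.
have uball : enorm ((enorm s)^-1 *: s - 0) <= 1.
  by rewrite subr0 enormZ gtr0_norm ?invr_gt0 // mulVf.
have ts : 0 < t * enorm s < del.
  by rewrite mulr_gt0 //=; apply: le_lt_trans sdel; rewrite ler_piMl // ltW.
(* compare the quotients of step t |s| and |s| along the direction s / |s| *)
have := Pdel _ uball (t * enorm s) (enorm s) ts; rewrite sn sdel => /(_ isT).
rewrite /Q !scalerA -mulrA mulfV // mulr1 scale1r.
rewrite -(ler_pM2l (mulr_gt0 tp sn)) -[X in X * enorm _ <= _]gtr0_norm ?mulr_gt0 //.
rewrite -enormZ scalerBr !scalerA mulfV ?mulf_neq0 // scale1r mulfK //.
move/le_trans; apply; rewrite mulrC ler_pM2l //.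
by rewrite ler_piMl // ltW.
Qed.

End DirectionalDerivative.

Section QuadraticExpansion.
Context {R : realType} {d : nat}.

(** On the segment from xhat to xhat + s the gradient at parameter t is t times
    the one at the end point, up to e |s| ([directional_uniform]); the mean
    value theorem for I(xhat + t s) - t^2 <F(xhat + s), s> / 2 then gives the
    expansion with its factor 1/2. *)
Lemma quadratic_expansion (I : 'rV[R]_d -> R) (F : 'rV[R]_d -> 'rV[R]_d) m K xhat :
  0 <= m -> 0 < K -> convex_gradient m K I F ->
  directionally_differentiable F xhat -> F xhat = 0 ->
  forall e : R, 0 < e -> \forall s \near (0 : 'rV[R]_d),
    2^-1 * inner (F (xhat + s)) s - e * enorm s ^+ 2 <= I (xhat + s) - I xhat.
Proof.
move=> m0 K0 IF ddF F0 e e0; have gradE := convex_gradient_grad m0 IF.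
have := directional_uniform K0 IF.2 ddF e0; apply: filterS => s.
rewrite F0 => Fs.
set c := inner (F (xhat + s)) s.
have dphi t : is_derive t (1 : R)
    (fun t : R => I (xhat + t *: s) - (2^-1 * c) * t ^+ 2)
    (inner (F (xhat + t *: s)) s - c * t).
  apply: is_deriveB.
    by rewrite -gradE; apply: is_derive_line;
      case: (convex_gradientP m0 IF (xhat + t *: s)).
  by apply: is_derive_eq; rewrite /GRing.scale /=; field.
have [t /andP[t0 t1]] := @is_derive_MVT _ _ _ dphi.
rewrite scale1r scale0r addr0 expr1n expr0n mulr0 mulr1 subr0.
have /Fs : 0 <= t <= 1 by rewrite !ltW.
rewrite !subr0 => h.
have : - (e * enorm s ^+ 2) <= inner (F (xhat + t *: s)) s - c * t.
  have -> : inner (F (xhat + t *: s)) s - c * t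
    = inner (F (xhat + t *: s) - t *: F (xhat + s)) s.
    by rewrite innerDl innerNl innerZl mulrC.
  have := norm_inner_le (F (xhat + t *: s) - t *: F (xhat + s)) s.
  rewrite ler_norml => /andP[+ _]; apply: le_trans.
  by rewrite lerN2 expr2 mulrA ler_wpM2r ?enorm_ge0.
move=> {dphi Fs h}; move: (e * _) => a; move: (inner (F (xhat + t *: s)) s - _) => b.
lra.
Qed.

End QuadraticExpansion.

(** * The semismooth Newton method for a strongly convex objective *)

Section Powers.
Context {R : realType}.

Lemma powR_le_exp (a r s : R) : 0 <= a <= 1 -> 0 < s <= r -> a `^ r <= a `^ s.
Proof.
move=> /andP[a0 a1] /andP[s0 sr].
have [->|an] := eqVneq a 0.
  by rewrite !powR0 ?gt_eqF // (lt_le_trans s0).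
by apply: ger_powR => //; rewrite lt_neqAle eq_sym an a0.
Qed.

Lemma near0_powR (tau eps : R) : 0 < tau -> 0 < eps ->
  exists2 del : R, 0 < del & forall a, 0 <= a < del -> a `^ (1 + tau) <= eps * a.
Proof.
move=> tau0 e0.
exists (eps `^ tau^-1); first exact: powR_gt0.
move=> a /andP[a0 adel]; rewrite powRD; last first.
  by rewrite gt_eqF // addr_gt0.
rewrite powRr1 // mulrC ler_wpM2r //.
have -> : eps = (eps `^ tau^-1) `^ tau by rewrite -powRrM mulVf ?gt_eqF // powRr1
  ?ltW.
by apply: ge0_ler_powR; rewrite ?nnegrE ?powR_ge0 // ltW.
Qed.

End Powers.

Section NewtonStep.
Context {R : realType} {d : nat}.
Variables (D : set 'rV[R]_d) (I : 'rV[R]_d -> R) (F : 'rV[R]_d -> 'rV[R]_d)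
  (dF : 'rV[R]_d -> set 'M[R]_d).
Variables (gamma rho tau1 tau2 tau : R).
Variables (m K m1 M1 : R).
Hypotheses (DT : forall xi, D xi) (m_gt0 : 0 < m) (K_gt0 : 0 < K)
  (m1_gt0 : 0 < m1) (M1_gt0 : 0 < M1).
Hypothesis IF : convex_gradient m K I F.
Hypothesis dF_bounded : forall xi W, dF xi W -> sym_bounded m1 M1 W.
Hypotheses (gamma_itv : 0 < gamma < 1 / 2) (rho_itv : 0 < rho < 1)
  (tau1_itv : 0 < tau1 < 1) (tau2_itv : 0 < tau2 < 1) (tau_itv : 0 < tau <= 1).
Implicit Types (x y e dir : 'rV[R]_d) (W : 'M[R]_d).

(** Strong monotonicity of F: it makes F injective, and turns convergence of
    the values of F into convergence of the arguments. *)
Lemma gradient_expands x y : 2 * m * enorm (y - x) <= enorm (F y - F x).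
Proof.
have := convex_gradient_monotone IF x y.
move=> /le_trans /(_ (inner_le _ _)).
have [->|v0] := eqVneq (enorm (y - x)) 0.
  by move=> _; rewrite mulr0 enorm_ge0.
have vn : 0 < enorm (y - x) by rewrite lt_neqAle eq_sym v0 enorm_ge0.
by rewrite expr2 mulrA ler_pM2r.
Qed.

(** The regularization parameter eta of the Newton system at x. *)
Definition newton_shift x : R := tau1 * Num.min tau2 (enorm (F x)).

Lemma newton_shift_itv x : 0 <= newton_shift x <= 1.
Proof.
case/andP: tau1_itv => t0 t1; case/andP: tau2_itv => s0 s1.
have h0 : 0 <= Num.min tau2 (enorm (F x)) by rewrite le_min (ltW s0) enorm_ge0.
have h1 : Num.min tau2 (enorm (F x)) <= 1 by rewrite ge_min (ltW s1).
by rewrite mulr_ge0 ?(ltW t0) //= mulr_ile1 // ltW.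
Qed.

Lemma newton_shift_le x : newton_shift x <= tau1 * enorm (F x).
Proof.
case/andP: tau1_itv => t0 t1.
by rewrite /newton_shift ler_pM2l // ge_min lexx orbT.
Qed.

Definition residual_small x W dir : Prop :=
  enorm (dir *m (W + (newton_shift x)%:M) + F x)
    <= Num.min (newton_shift x) (enorm (F x) `^ (1 + tau)).

Let c1 := (2 * (M1 + 1))^-1.
Let c2 := 2 / m1.

Let c1_gt0 : 0 < c1.
Proof. by rewrite invr_gt0 mulr_gt0 // addr_gt0. Qed.

Lemma newton_direction_le x W dir : dF x W -> residual_small x W dir ->
  enorm dir <= 2 / m1 * enorm (F x).
Proof.
move=> /dF_bounded /(sym_bounded_shift (newton_shift_itv x)) WS res.
rewrite mulrAC ler_pdivlMr // mulrC.
apply: le_trans (sym_bounded_le dir WS) _.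
set v := dir *m _ in res *; rewrite -[v](addrK (F x)).
apply: le_trans (enormBD _ _) _; rewrite mulrDl mul1r lerD2r.
apply: le_trans res _; rewrite ge_min; apply/orP; left.
apply: le_trans (newton_shift_le x) _.
by case/andP: tau1_itv => _ /ltW t1; rewrite ler_piMl ?enorm_ge0.
Qed.

(** The shifted matrix is symmetric positive definite, so conjugate gradients
    give a descent direction.  The inexactness test excludes the zero direction
    of k = 0 unless F x vanishes. *)
Lemma newton_direction_descent x W dir k : dF x W -> residual_small x W dir ->
  dir = cg_iterate (W + (newton_shift x)%:M) (- F x) k ->
  inner (F x) dir <= - ((2 * (M1 + 1))^-1 * enorm (F x) ^+ 2).
Proof.
move=> /dF_bounded /(sym_bounded_shift (newton_shift_itv x)) WS res dirE.
case: k dirE => [|k] dirE.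
  (* without any iteration the residual is F x, which must then vanish *)
  suff -> : F x = 0 by rewrite inner0l enorm0 expr0n mulr0 oppr0.
  move: res; rewrite /residual_small dirE /cg_iterate /= mul0mx add0r le_min.
  case/andP => /le_trans/(_ (newton_shift_le x)) h _; apply: enorm_eq0.
  case/andP: tau1_itv => _ t1; apply/eqP.
  rewrite eq_le enorm_ge0 andbT; apply: contraT; rewrite -ltNge => F0.
  by move: h; rewrite -[leLHS]mul1r ler_pM2r // leNgt t1.
have M10 : 0 < M1 + 1 by rewrite addr_gt0.
have := cg_descent (- F x) m1_gt0 M10 WS (ltn0Sn k).
by rewrite -dirE enormN innerNl lerNr mulrC.
Qed.

Lemma newton_stepP x x' :
  newton_step D I F dF gamma rho tau1 tau2 tau x x' ->
  exists W dir l, [/\ dF x W, residual_small x W dir,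
    inner (F x) dir <= - (c1 * enorm (F x) ^+ 2) /\ enorm dir <= c2 * enorm (F x),
    armijo D I gamma rho x dir l /\
      (forall l', (l' < l)%N -> ~ armijo D I gamma rho x dir l')
    & x' = x + rho ^+ l *: dir].
Proof.
move=> [W [dir [l /= [dFW [k dirE] res arm x'E]]]].
exists W, dir, l; split=> //; split.
  exact: newton_direction_descent dirE.
exact: newton_direction_le res.
Qed.

Let armijoE x dir l : armijo D I gamma rho x dir l <->
  I (x + rho ^+ l *: dir) <= I x + gamma * rho ^+ l * inner (F x) dir.
Proof.
have gradE : grad I = F by rewrite (convex_gradient_grad (ltW m_gt0) IF).
by rewrite /armijo gradE; split=> [[]|].
Qed.

Let t0 := (1 - gamma) * c1 / (K * c2 ^+ 2).
Let t1 := Num.min 1 (rho * t0).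

Let gamma_lt1 : 0 < 1 - gamma.
Proof. by case/andP: gamma_itv => _; lra. Qed.

Let t0_gt0 : 0 < t0.
Proof.
have c2_gt0 : 0 < c2 by rewrite divr_gt0.
apply: divr_gt0; first exact: mulr_gt0.
by apply: mulr_gt0 => //; exact: exprn_gt0.
Qed.

(** By the quadratic upper bound of I, the Armijo test holds for every step
    below a threshold t0 that does not depend on x. *)
Let armijo_small x dir l : inner (F x) dir <= - (c1 * enorm (F x) ^+ 2) ->
  enorm dir <= c2 * enorm (F x) -> rho ^+ l <= t0 -> armijo D I gamma rho x dir l.
Proof.
move=> desc dirle lt0; apply/armijoE; apply: le_trans (convex_gradient_ub (ltW
  m_gt0) IF x _) _.
rewrite [x + _ - x]addrAC subrr add0r innerZr.
set t := rho ^+ l in lt0 *.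
have t_gt0 : 0 < t by rewrite exprn_gt0 //; case/andP: rho_itv.
rewrite -addrA lerD2l enormZ gtr0_norm // exprMn.
have dir2 : enorm dir ^+ 2 <= c2 ^+ 2 * enorm (F x) ^+ 2.
  rewrite -exprMn ler_pXn2r ?nnegrE ?enorm_ge0 //.
  by rewrite mulr_ge0 ?enorm_ge0 // divr_ge0 // ltW.
have h1 : K * t * enorm dir ^+ 2 <= (1 - gamma) * (c1 * enorm (F x) ^+ 2).
  apply: le_trans (ler_wpM2l (ltW (mulr_gt0 K_gt0 t_gt0)) dir2) _.
  have c2_gt0 : 0 < c2 by rewrite divr_gt0.
  have c22 : 0 < K * c2 ^+ 2 by rewrite mulr_gt0 // exprn_gt0.
  have lt0' : t * (K * c2 ^+ 2) <= (1 - gamma) * c1 by rewrite -ler_pdivlMr.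
  have := ler_wpM2r (sqr_ge0 (enorm (F x))) lt0'.
  have -> : K * t * (c2 ^+ 2 * enorm (F x) ^+ 2)
    = t * (K * c2 ^+ 2) * enorm (F x) ^+ 2 by ring.
  by rewrite (mulrA (1 - gamma)).
have h2 := ler_wpM2l (ltW gamma_lt1) desc.
have h3 : K * t * enorm dir ^+ 2 + (1 - gamma) * inner (F x) dir <= 0.
  by have := lerD h1 h2; rewrite mulrN subrr.
have := ler_wpM2l (ltW t_gt0) h3; rewrite mulr0.
by move: (inner _ _) (enorm dir ^+ 2) => i e; lra.
Qed.

(** Since the accepted step is the largest power of rho that passes, it is at
    least t1: it is 1, or the previous power failed and so exceeded t0. *)
Lemma newton_step_decrease : exists2 c : R, 0 < c &
  forall x x', newton_step D I F dF gamma rho tau1 tau2 tau x x' ->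
    I x' <= I x - c * enorm (F x) ^+ 2.
Proof.
have [rho0 rho1] := andP rho_itv; have [gamma0 _] := andP gamma_itv.
have t1_gt0 : 0 < t1 by rewrite lt_min ltr01 mulr_gt0.
exists (gamma * t1 * c1); first by rewrite !mulr_gt0.
move=> x x' /newton_stepP[W [dir [l [_ _ [desc dirle] [arm armmin] ->]]]].
have lt1 : t1 <= rho ^+ l.
  case: l arm armmin => [_ _|l _ /(_ l (ltnSn l)) narm].
    by rewrite expr0 ge_min lexx.
  rewrite ge_min exprS ler_pM2l //; apply/orP; right; rewrite leNgt.
  by apply/negP => /ltW lt0; apply: narm; exact: armijo_small.
move/armijoE : arm => /le_trans; apply; rewrite lerD2l.
have gr : 0 < gamma * rho ^+ l by rewrite mulr_gt0 // exprn_gt0.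
apply: le_trans (ler_wpM2l (ltW gr) desc) _.
rewrite mulrN lerN2 -mulrA -!(mulrA gamma) ler_pM2l // ler_wpM2r //.
by rewrite mulr_ge0 ?sqr_ge0 // ltW.
Qed.

Section Sequence.
Variable xi : nat -> 'rV[R]_d.
Hypothesis xi_step : forall j, newton_step D I F dF gamma rho tau1 tau2 tau (xi
  j) (xi j.+1).

(** The values of I decrease and are bounded below (by strong convexity), so
    their differences, which dominate |F|^2, tend to 0. *)
Lemma newton_residual_cvg0 : forall e : R, 0 < e ->
  \forall j \near \oo, enorm (F (xi j)) < e.
Proof.
have [c c0 dec] := newton_step_decrease; pose u j : R := I (xi j).
have uS j : u j.+1 <= u j - c * enorm (F (xi j)) ^+ 2 by apply: dec.
have u_cvg : cvgn u.
  apply: nonincreasing_is_cvgn.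
    apply/nonincreasing_seqP => j; apply: le_trans (uS j) _.
    by rewrite gerBl mulr_ge0 ?sqr_ge0 // ltW.
  (* strong convexity at xi 0 bounds I below by a quadratic in the distance w
     to xi 0, whose minimum - |F|^2 / (4 m) is reached at w = |F| / (2 m) *)
  exists (u 0%N - enorm (F (xi 0%N)) ^+ 2 / (4 * m)) => _ [j _ <-].
  have := IF.1 (xi 0%N) (xi j); rewrite -/(u j) -/(u 0%N).
  have := norm_inner_le (F (xi 0%N)) (xi j - xi 0%N).
  rewrite ler_norml => /andP[+ _].
  move: (u 0%N) (u j) (enorm (_ - _)) (enorm (F _)) (inner _ _) => u0 uj w f i.
  move=> lo sub; apply: le_trans sub; rewrite -addrA lerD2l.
  apply: (@le_trans _ _ (- (f * w) + m * w ^+ 2)); last by rewrite lerD2r.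
  rewrite -subr_ge0.
  have -> : - (f * w) + m * w ^+ 2 - - (f ^+ 2 / (4 * m))
      = (2 * m * w - f) ^+ 2 / (4 * m) by field; rewrite gt_eqF.
  by rewrite mulr_ge0 ?sqr_ge0 // invr_ge0 mulr_ge0 // ltW.
move=> e e0; have ce : 0 < c * e ^+ 2 / 2 by rewrite divr_gt0 // mulr_gt0 //
  exprn_gt0.
have /cvgrPdist_lt /(_ _ ce) [N _ Nu] := u_cvg.
exists N => // j Nj.
have := Nu j Nj; have := Nu j.+1 (leqW Nj); have := uS j.
rewrite /= !ltr_norml => us /andP[h1 h2] /andP[h3 h4].
rewrite -(ltr_pXn2r (n := 2)) ?nnegrE ?enorm_ge0 ?(ltW e0) // -(ltr_pM2l c0).
move: us h1 h2 h3 h4; move: (lim _) (u j) (u j.+1) (c * _) (c * _) => *; lra.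
Qed.

(** Strong monotonicity bounds |xi_j - xi_k| by the sizes of F there, so the
    sequence is Cauchy. *)
Lemma newton_sequence_cvg : exists2 xhat, F xhat = 0 & xi @ \oo --> xhat.
Proof.
have xi_cvg : cvg (xi @ \oo).
  apply/cauchy_cvgP/cauchy_exP => e /= e0.
  have me : 0 < m * e by rewrite mulr_gt0.
  have [N _ Nres] := newton_residual_cvg0 me.
  exists (xi N); exists N => // j /= Nj.
  rewrite -ball_normE /=; apply: le_lt_trans (norm_le_enorm _) _.
  have := le_trans (gradient_expands (xi j) (xi N)) (enormBD _ _).
  have := Nres _ Nj; have := Nres _ (leqnn N); rewrite /= => h1 h2 h3.
  rewrite -(ltr_pM2l m_gt0); move: h1 h2 h3; rewrite -mulrA.
  move: (m * _) (m * _) (enorm _) (enorm _) => *; lra.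
exists (lim (xi @ \oo)) => //; set xh := lim _.
have Fxh (e : R) : 0 < e -> enorm (F xh) <= 0 + e.
  move=> e0; have e2 : 0 < e / 2 by rewrite divr_gt0.
  have eK : 0 < e / 2 / K by rewrite divr_gt0.
  have /cvg_enormP/cvgrPdist_lt/(_ _ eK)[N1 _ h1] := xi_cvg.
  have [N2 _ h2] := newton_residual_cvg0 e2.
  have := h1 (maxn N1 N2) (leq_maxl _ _); have := h2 (maxn N1 N2) (leq_maxr _ _).
  rewrite /= sub0r normrN ger0_norm ?enorm_ge0 // -/xh => h3.
  rewrite ltr_pdivlMr // => h4.
  have := IF.2 (xi (maxn N1 N2)) xh; rewrite (enormB xh).
  have := enormD (F xh - F (xi (maxn N1 N2))) (F (xi (maxn N1 N2))); rewrite subrK.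
  move: h3 h4; rewrite [_ * K]mulrC.
  move: (enorm _) (enorm _) (enorm _) (K * _) => *; lra.
by apply: enorm_eq0; apply/eqP; rewrite eq_le enorm_ge0 andbT; apply/ler_addgt0Pr.
Qed.

End Sequence.

Variable xhat : 'rV[R]_d.
Hypothesis Fxhat : F xhat = 0.

(** (x + dir - xhat)(W + eta) = - (F x - F xhat - (x - xhat) W)
    + eta (x - xhat) + residual, and W + eta >= m1.  The regularization eta is
    at most |F x| <= K |x - xhat|. *)
Lemma newton_direction_error x W dir : dF x W -> residual_small x W dir ->
  m1 * enorm (x + dir - xhat) <=
    enorm (F x - F xhat - (x - xhat) *m W)
    + K * enorm (x - xhat) ^+ 2 + (K * enorm (x - xhat)) `^ (1 + tau).
Proof.
move=> dFW res; have FK : enorm (F x) <= K * enorm (x - xhat).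
  by have := IF.2 xhat x; rewrite Fxhat subr0.
have WS := sym_bounded_shift (newton_shift_itv x) (dF_bounded dFW).
apply: le_trans (sym_bounded_le _ WS) _.
have -> : (x + dir - xhat) *m (W + (newton_shift x)%:M)
  = - (F x - F xhat - (x - xhat) *m W) + newton_shift x *: (x - xhat)
    + (dir *m (W + (newton_shift x)%:M) + F x).
  have -> : x + dir - xhat = (x - xhat) + dir by rewrite addrAC.
  move: (x - xhat) => e; rewrite Fxhat subr0 mulmxDl mulmxDr mul_mx_scalar.
  by rewrite opprB (addrAC _ (- F x)) [_ *m _ + F x]addrC addrA subrK.
apply: le_trans (enormD _ _) _; apply: lerD.
  apply: le_trans (enormD _ _) _; rewrite enormN lerD2l enormZ.
  have /andP[s0 _] := newton_shift_itv x.
  rewrite ger0_norm // expr2 mulrA ler_wpM2r ?enorm_ge0 //.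
  apply: le_trans FK; apply: le_trans (newton_shift_le x) _.
  by case/andP: tau1_itv => _ /ltW ?; rewrite ler_piMl ?enorm_ge0.
apply: le_trans res _; rewrite ge_min; apply/orP; right.
case/andP: tau_itv => tau0 _.
by apply: ge0_ler_powR; rewrite ?nnegrE ?addr_ge0 ?mulr_ge0 ?enorm_ge0 // ltW.
Qed.

Hypothesis ddF : directionally_differentiable F xhat.
Hypothesis ssF : forall eps : R, 0 < eps -> \forall s \near (0 : 'rV[R]_d),
  forall W, dF (xhat + s) W ->
    enorm (F (xhat + s) - F xhat - s *m W) <= eps * enorm s.

Lemma newton_direction_superlinear (eps : R) : 0 < eps ->
  \forall s \near (0 : 'rV[R]_d), forall W dir, dF (xhat + s) W ->
    residual_small (xhat + s) W dir -> enorm (s + dir) <= eps * enorm s.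
Proof.
move=> e0; have e3 : 0 < eps * m1 / 3 by rewrite divr_gt0 // mulr_gt0.
have eK : 0 < eps * m1 / 3 / K by rewrite divr_gt0.
have [del del0 powP] := near0_powR (andP tau_itv).1 eK.
have delK : 0 < del / K by rewrite divr_gt0.
have near_del : \forall s \near (0 : 'rV[R]_d), enorm s < del / K.
  by apply/near0_enormP; exists (del / K).
apply: filterS (filterI (ssF e3) (filterI (near0_mul_sqr K e3) near_del)) => s
  [gap [sq sdel]] W dir dFW res.
have := newton_direction_error dFW res.
have -> : xhat + s + dir - xhat = s + dir by rewrite -(addrA xhat) [LHS]addrAC
  subrr add0r.
rewrite [xhat + s - xhat]addrAC subrr add0r => err.
have := powP (K * enorm s).
rewrite mulr_ge0 ?enorm_ge0 ?(ltW K_gt0) //= mulrC -ltr_pdivlMr // => /(_ sdel).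
rewrite [enorm s * K]mulrC mulrA divfK ?gt_eqF // => pw.
rewrite -(ler_pM2l m1_gt0); move: err (gap W dFW) sq pw.
have -> : m1 * (eps * enorm s) = 3 * (eps * m1 / 3 * enorm s) by field.
by move: (m1 * _) (enorm (_ - _)) (K * _) (_ `^ _) (eps * m1 / 3 * _) => *; lra.
Qed.

(** Writing x = xhat + s, the full step reaches a value of I within
    K eps |s|^2 of the minimum, while I(x) exceeds it by <F x, s> / 2, which is
    about - <F x, dir> / 2.  The Armijo test asks for a decrease of only
    - gamma <F x, dir>, and the gap (1/2 - gamma) |<F x, dir>| is at least
    q |s|^2, which absorbs all errors when (2 K + 1) eps <= q. *)
Lemma newton_full_step : \forall s \near (0 : 'rV[R]_d),
  forall x', newton_step D I F dF gamma rho tau1 tau2 tau (xhat + s) x' ->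
  exists W dir, [/\ dF (xhat + s) W, residual_small (xhat + s) W dir
    & x' = xhat + s + dir].
Proof.
have [gamma0 gamma2] := andP gamma_itv.
pose q := (1 / 2 - gamma) * (c1 * (2 * m) ^+ 2).
have q0 : 0 < q.
  by rewrite !mulr_gt0 ?subr_gt0 // exprn_gt0 // mulr_gt0.
pose eps := Num.min 1 (q / (2 * K + 1)).
have K21 : 0 < 2 * K + 1 by rewrite addr_gt0 // mulr_gt0.
have eps0 : 0 < eps by rewrite lt_min ltr01 divr_gt0.
apply: filterS (filterI (newton_direction_superlinear eps0)
  (quadratic_expansion (ltW m_gt0) K_gt0 IF ddF Fxhat eps0)) => s [super quad] x'.
move=> /newton_stepP[W [dir [l [dFW res [desc dirle] [arm armmin] x'E]]]].
exists W, dir; split=> //.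
(* the accepted exponent is minimal, so it is 0 once 0 passes the test *)
suff l0 : armijo D I gamma rho (xhat + s) dir 0.
  case: l armmin {arm} x'E => [_ ->|l armmin _]; first by rewrite expr0 scale1r.
  by have := armmin 0%N (ltn0Sn l).
apply/armijoE; rewrite expr0 scale1r mulr1.
have := convex_gradient_ub (ltW m_gt0) IF xhat (xhat + s + dir).
have -> : xhat + s + dir - xhat = s + dir by rewrite -(addrA xhat) [LHS]addrAC
  subrr add0r.
rewrite Fxhat inner0l addr0 => ub.
have s0 := enorm_ge0 s.
have sup := super _ _ dFW res.
have sup2 : enorm (s + dir) ^+ 2 <= eps * enorm s ^+ 2.
  apply: le_trans (_ : _ <= (eps * enorm s) ^+ 2) _.
    by rewrite ler_pXn2r ?nnegrE ?enorm_ge0 // mulr_ge0 // ltW.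
  rewrite exprMn ler_wpM2r ?sqr_ge0 // expr2 ler_piMl ?(ltW eps0) //.
  by rewrite ge_min lexx.
have Fs : enorm (F (xhat + s)) <= K * enorm s.
  by have := IF.2 xhat (xhat + s); rewrite Fxhat subr0 [_ + s - _]addrAC subrr add0r.
have Fs2 : (2 * m) ^+ 2 * enorm s ^+ 2 <= enorm (F (xhat + s)) ^+ 2.
  have := gradient_expands xhat (xhat + s).
  rewrite Fxhat subr0 [_ + s - _]addrAC subrr add0r -exprMn => h.
  by rewrite ler_pXn2r ?nnegrE ?enorm_ge0 // mulr_ge0 // mulr_ge0 // ltW.
have cross : - inner (F (xhat + s)) (s + dir) <= K * (eps * enorm s ^+ 2).
  rewrite -innerNl; apply: le_trans (inner_le _ _) _; rewrite enormN.
  have -> : K * (eps * enorm s ^+ 2) = (K * enorm s) * (eps * enorm s) by ring.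
  by apply: ler_pM; rewrite ?enorm_ge0.
have qs : (1 / 2 - gamma) * inner (F (xhat + s)) dir <= - (q * enorm s ^+ 2).
  have g2 : 0 <= 1 / 2 - gamma by rewrite subr_ge0 ltW.
  apply: le_trans (ler_wpM2l g2 desc) _.
  have -> : q * enorm s ^+ 2
    = (1 / 2 - gamma) * (c1 * ((2 * m) ^+ 2 * enorm s ^+ 2)) by rewrite /q; ring.
  rewrite mulrN lerN2; apply: ler_wpM2l => //.
  by apply: ler_wpM2l => //; exact: ltW.
have epsq : (2 * K + 1) * (eps * enorm s ^+ 2) <= q * enorm s ^+ 2.
  rewrite mulrA ler_wpM2r ?sqr_ge0 // mulrC -ler_pdivlMr //.
  by rewrite ge_min lexx orbT.
have ub2 := le_trans ub (lerD (lexx _) (ler_wpM2l (ltW K_gt0) sup2)).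
have K0 : 0 <= K * (eps * enorm s ^+ 2).
  by rewrite mulr_ge0 ?(ltW K_gt0) // mulr_ge0 ?sqr_ge0 // ltW.
rewrite innerDr in cross.
move: quad ub2 cross qs epsq K0.
move: (q * _) (eps * _) (inner _ dir) => a1 a2 a3.
move: (I _) (I _) (I _) (inner _ _) => *; lra.
Qed.

Section LocalRates.
Variable xi : nat -> 'rV[R]_d.
Hypothesis xi_step : forall j, newton_step D I F dF gamma rho tau1 tau2 tau (xi
  j) (xi j.+1).
Hypothesis xi_cvg : xi @ \oo --> xhat.

Lemma near_error (P : 'rV[R]_d -> Prop) : (\forall s \near (0 : 'rV[R]_d), P s) ->
  \forall j \near \oo, P (xi j - xhat).
Proof.
move=> /near0_enormP[del del0 dP].
have /cvg_enormP/cvgrPdist_lt/(_ _ del0) := xi_cvg.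
apply: filterS => j; rewrite sub0r normrN ger0_norm ?enorm_ge0 //.
exact: dP.
Qed.

(** Transfers a relation between the errors before and after a full step to
    consecutive errors of the sequence. *)
Lemma newton_eventually_full (P : R -> R -> Prop) :
  (\forall s \near (0 : 'rV[R]_d), forall W dir, dF (xhat + s) W ->
    residual_small (xhat + s) W dir -> P (enorm (s + dir)) (enorm s)) ->
  \forall j \near \oo, P (error xi xhat j.+1) (error xi xhat j).
Proof.
move=> sP; apply: filterS (near_error (filterI newton_full_step sP)) => j [full Pj].
have := xi_step j.
rewrite -{1}(subrKC xhat (xi j)) => /full[W [dir [dFW res xSE]]].
have := Pj W dir dFW res; rewrite /error xSE.
by have -> : xhat + (xi j - xhat) + dir - xhat = xi j - xhat + dir
  by rewrite -(addrA xhat) [LHS]addrAC subrr add0r.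
Qed.

Lemma newton_q_superlinear : q_superlinear xi xhat.
Proof.
split=> //; apply/eqoP => e e0.
have := newton_eventually_full (P := fun a b => a <= e * b)
  (newton_direction_superlinear e0).
apply: filterS => j; rewrite /error /= !ger0_norm ?enorm_ge0 //.
Qed.

Lemma newton_q_rate (nu C : R) : 0 < nu <= 1 ->
  (\forall s \near (0 : 'rV[R]_d), forall W, dF (xhat + s) W ->
    enorm (F (xhat + s) - F xhat - s *m W) <= C * enorm s `^ (1 + nu)) ->
  q_rate (1 + Num.min tau nu) xi xhat.
Proof.
move=> /andP[nu0 nu1] gapC; have [tau0 tau1'] := andP tau_itv.
set sigma := Num.min tau nu.
have sigma0 : 0 < sigma by rewrite lt_min tau0.
have s1 : 0 < 1 + sigma by rewrite addr_gt0.
pose C' := (`|C| + K + K `^ (1 + tau)) / m1.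
apply/eqO_exP; exists (C' + 1).
  by rewrite ltr_wpDl // divr_ge0 ?(ltW m1_gt0) // !addr_ge0 ?powR_ge0 // ltW.
have near1 : \forall s \near (0 : 'rV[R]_d), enorm s < 1.
  by apply/near0_enormP; exists 1.
have := @newton_eventually_full (fun a b => a <= C' * b `^ (1 + sigma)).
have H : \forall s \near (0 : 'rV[R]_d), forall W dir, dF (xhat + s) W ->
    residual_small (xhat + s) W dir -> enorm (s + dir) <= C' * enorm s `^ (1 + sigma).
  apply: filterS (filterI gapC near1) => s [gap sle1] W dir dFW res.
  have s01 : 0 <= enorm s <= 1 by rewrite enorm_ge0 ltW.
  have := newton_direction_error dFW res.
  have -> : xhat + s + dir - xhat = s + dir by rewrite -(addrA xhat) [LHS]addrAC
    subrr add0r.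
  rewrite [xhat + s - xhat]addrAC subrr add0r => err.
  rewrite /C' mulrAC ler_pdivlMr // mulrC; apply: le_trans err _.
  rewrite !mulrDl; apply: lerD; first apply: lerD.
  - apply: le_trans (gap W dFW) _.
    apply: le_trans (_ : _ <= `|C| * enorm s `^ (1 + nu)) _.
      by rewrite ler_wpM2r ?powR_ge0 // ler_norm.
    rewrite ler_wpM2l // powR_le_exp // s1 lerD2l.
    by rewrite ge_min lexx orbT.
  - rewrite ler_wpM2l ?(ltW K_gt0) // -powR_mulrn ?enorm_ge0 //.
    rewrite powR_le_exp // s1 -[2%:R]/(1 + 1 : R) lerD2l.
    by rewrite ge_min tau1'.
  - rewrite powRM ?enorm_ge0 ?(ltW K_gt0) // ler_wpM2l ?powR_ge0 // powR_le_exp //.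
    by rewrite s1 lerD2l ge_min lexx.
move=> /(_ H); apply: filterS => j; rewrite /= [`|error _ _ _|]ger0_norm
  ?enorm_ge0 //.
rewrite [`|_ `^ _|]ger0_norm ?powR_ge0 // => /le_trans; apply.
by rewrite ler_wpM2r ?powR_ge0 // lerDl.
Qed.

End LocalRates.

End NewtonStep.

(** * Block structure of the subproblem *)

Local Notation blk xi i := (@submxrow _ _ (fun=> _) 1 xi i).

Section Blocks.
Context {R : realType} {n b : nat}.
Notation V := 'rV[R]_n.
Notation VV := 'rV[R]_(\sum_(i < b) n).
Implicit Types (xi s u w : VV).

Lemma inner_blocks u w : inner u w = \sum_(i < b) inner (blk u i) (blk w i).
Proof.
rewrite inner_mulmx -{1}(submxrowK u) -{1}(submxrowK w) tr_mxrow mul_mxrow_mxcol.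
by rewrite summxE; apply: eq_bigr => i _; rewrite inner_mulmx.
Qed.

Lemma enorm_blocks u : enorm u ^+ 2 = \sum_(i < b) enorm (blk u i) ^+ 2.
Proof. by rewrite sqr_enorm inner_blocks; apply: eq_bigr => i _;
  rewrite sqr_enorm. Qed.

Lemma blockZ (a : R) u i : blk (a *: u) i = a *: blk u i.
Proof. by apply/matrixP => j k; rewrite !mxE. Qed.

Lemma blockD u w i : blk (u + w) i = blk u i + blk w i.
Proof. exact: submxrowD. Qed.

Lemma blockB u w i : blk (u - w) i = blk u i - blk w i.
Proof. exact: submxrowB. Qed.

Lemma block_le u i : enorm (blk u i) <= enorm u.
Proof.
rewrite -(ler_pXn2r (n := 2)) ?nnegrE ?enorm_ge0 // enorm_blocks (bigD1 i) //=.
by rewrite lerDl sumr_ge0 // => j _; rewrite sqr_ge0.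
Qed.

Lemma enorm_le_blocks u : enorm u <= \sum_(i < b) enorm (blk u i).
Proof.
have sum0 : 0 <= \sum_(i < b) enorm (blk u i) by apply: sumr_ge0 => i _;
  exact: enorm_ge0.
rewrite -(ler_pXn2r (n := 2)) ?nnegrE ?enorm_ge0 // enorm_blocks.
rewrite [leRHS]expr2 mulr_suml; apply: ler_sum => i _.
rewrite expr2 ler_wpM2l ?enorm_ge0 // (bigD1 i) //= lerDl.
by apply: sumr_ge0 => j _; exact: enorm_ge0.
Qed.

Lemma enorm_le_blocks_cst u (c : R) : (forall i, enorm (blk u i) <= c) ->
  enorm u <= b%:R * c.
Proof.
move=> uc; apply: le_trans (enorm_le_blocks u) _.
rewrite mulr_natl -[X in _ *+ X](card_ord b) -sumr_const.
exact: ler_sum.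
Qed.

Definition block_sum u : V := \sum_(i < b) blk u i.

Lemma block_sumD u w : block_sum (u + w) = block_sum u + block_sum w.
Proof. by rewrite /block_sum -big_split; apply: eq_bigr => i _; rewrite blockD. Qed.

Lemma block_sumZ (a : R) u : block_sum (a *: u) = a *: block_sum u.
Proof. by rewrite /block_sum scaler_sumr; apply: eq_bigr => i _; rewrite blockZ. Qed.

Lemma block_sum_le u : enorm (block_sum u) <= b%:R * enorm u.
Proof.
apply: le_trans (enorm_sum _) _.
rewrite mulr_natl -[X in _ *+ X](card_ord b) -sumr_const.
by apply: ler_sum => i _; exact: block_le.
Qed.

Lemma inner_block_sumr (a : V) u : inner a (block_sum u) = \sum_i inner a (blk u i).
Proof.
rewrite /block_sum; elim/big_ind2: _ => // [|x1 x2 y1 y2 <- <-].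
  by rewrite inner0r.
by rewrite innerDr.
Qed.

End Blocks.

Section Subproblem.
Context {R : realType} {n b : nat}.
Variables (p : 'I_b -> 'rV[R]_n -> R) (theta : 'rV[R]_n -> \bar R).
Variables (alpha : R) (x v : 'rV[R]_n).
Notation VV := 'rV[R]_(\sum_(i < b) n).
Notation P := (prox (escale alpha theta)).
Notation G i := (grad_conj (p i)).
Notation F := (sub_F p theta alpha x v).
Notation I := (sub_I p theta alpha x v).
Notation z := (sub_z alpha x v).
Notation dF := (sub_dF p theta alpha x v).
Variables (m K : R).
Hypotheses (b_gt0 : (0 < b)%N) (alpha_gt0 : 0 < alpha) (m_gt0 : 0 < m) (K_gt0 : 0
  < K).
Hypothesis pG : forall i, convex_gradient m K (fine \o conj (p i)) (G i).
Hypothesis thetaP : convex_gradient 0 2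
  (fun x => 2^-1 * enorm x ^+ 2 - fine (env (escale alpha theta) x)) P.
Implicit Types (xi s u w : VV).

Let bR_gt0 : 0 < b%:R :> R. Proof. by rewrite ltr0n. Qed.

(** The linear part of the affine map sub_z. *)
Definition sub_dz (s : VV) : 'rV[R]_n := - ((alpha / b%:R) *: block_sum s).

Lemma sub_zD xi s : z (xi + s) = z xi + sub_dz s.
Proof.
rewrite /sub_z -!/(block_sum _) block_sumD scalerDr opprD /sub_dz.
by rewrite !addrA [LHS]addrAC.
Qed.

Lemma sub_dzZ (t : R) s : sub_dz (t *: s) = t *: sub_dz s.
Proof. by rewrite /sub_dz block_sumZ scalerN !scalerA mulrC. Qed.

Lemma sub_dz_le s : enorm (sub_dz s) <= alpha * enorm s.
Proof.
rewrite /sub_dz enormN enormZ gtr0_norm ?divr_gt0 //.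
apply: le_trans (ler_wpM2l _ (block_sum_le s)) _; first by rewrite divr_ge0 // ltW.
by rewrite mulrA divfK // gt_eqF.
Qed.

Lemma sub_F_block xi i : blk (F xi) i = G i (blk xi i) - P (z xi).
Proof. by rewrite /sub_F mxrowK. Qed.

Lemma sub_F_blockB xi xi' i : blk (F xi' - F xi) i
  = (G i (blk xi' i) - G i (blk xi i)) - (P (z xi') - P (z xi)).
Proof.
move: (sub_F_block xi' i) (sub_F_block xi i).
move: (F xi') (F xi) (G i (blk xi' i)) (G i (blk xi i)) (P (z xi')) (P (z xi)) =>
  a1 a2 b1 b2 c1 c2 e1 e2.
by rewrite blockB e1 e2 !opprB [c2 - b2]addrC addrACA [- c1 + c2]addrC.
Qed.

(** Up to a factor b / alpha, the last two terms of the objective are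
    |.|^2 / 2 - env evaluated at z(xi).  Its gradient there is prox(z(xi)), and
    the factor cancels against the slope - alpha / b of z in each block. *)
Lemma sub_convex_gradient : convex_gradient m (b%:R * (K + 2 * alpha)) I F.
Proof.
split=> xi xi'; set s := xi' - xi.
all: have dzE : z xi' - z xi = sub_dz s
  by rewrite -[xi'](subrKC xi) sub_zD [LHS]addrAC subrr add0r.
  have zP := thetaP.1 (z xi) (z xi').
  have pP i := (pG i).1 (blk xi i) (blk xi' i).
  have ba : 0 < b%:R / alpha by rewrite divr_gt0.
  have IE y : I y = \sum_i (fine \o conj (p i)) (blk y i) + b%:R / alpha *
      (2^-1 * enorm (z y) ^+ 2 - fine (env (escale alpha theta) (z y))).
    rewrite /sub_I -addrA mulrBr; congr (_ + (_ - _)).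
    by field; rewrite gt_eqF.
  rewrite !IE; have {zP} := ler_wpM2l (ltW ba) zP.
  rewrite dzE mul0r addr0 mulrDr.
  have -> : b%:R / alpha * inner (P (z xi)) (sub_dz s)
      = - \sum_i inner (P (z xi)) (blk s i).
    rewrite /sub_dz innerNr innerZr mulrN inner_block_sumr mulrA.
    by rewrite [_ * (alpha / _)](_ : _ = 1) ?mul1r //; field; rewrite !gt_eqF.
  have : \sum_i ((fine \o conj (p i)) (blk xi i) + inner (G i (blk xi i)) (blk s i)
       + m * enorm (blk s i) ^+ 2) <= \sum_i (fine \o conj (p i)) (blk xi' i).
    by apply: ler_sum => i _; have := pP i; rewrite -blockB.
  rewrite !big_split /= -mulr_sumr -enorm_blocks.
  have -> : inner (F xi) s = \sum_i inner (G i (blk xi i)) (blk s i)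
      - \sum_i inner (P (z xi)) (blk s i).
    rewrite inner_blocks -sumrB; apply: eq_bigr => i _.
    by rewrite sub_F_block innerDl innerNl.
  move=> h1 h2; apply: le_trans (lerD h1 h2).
  by rewrite le_eqVlt; apply/orP; left; apply/eqP; ring.
suff bnd i : enorm (blk (F xi' - F xi) i) <= (K + 2 * alpha) * enorm s.
  by have := enorm_le_blocks_cst bnd; rewrite mulrA.
rewrite sub_F_blockB.
apply: le_trans (enormBD _ _) _; rewrite mulrDl; apply: lerD.
  apply: le_trans ((pG i).2 _ _) _; rewrite -blockB ler_pM2l //.
  exact: block_le.
apply: le_trans (thetaP.2 _ _) _; rewrite -mulrA ler_pM2l //.
by rewrite dzE; exact: sub_dz_le.
Qed.

Lemma sub_dF_block s (H : 'I_b -> 'M[R]_n) (U : 'M[R]_n) i :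
  blk (s *m (\mxdiag_i H i + (alpha * b%:R) *: (sub_A *m U *m sub_A^T))) i
  = blk s i *m H i - sub_dz s *m U.
Proof.
rewrite mulmxDr blockD; congr (_ + _).
  by rewrite -{1}(submxrowK s) mul_mxrow_mxdiag mxrowK.
have sA : s *m sub_A = b%:R^-1 *: block_sum s.
  rewrite /sub_A -scalemxAr -{1}(submxrowK s) mul_mxrow_mxcol; congr (_ *: _).
  by apply: eq_bigr => j _; rewrite mulmx1.
rewrite -scalemxAr !mulmxA sA /sub_A linearZ /= tr_mxcol -scalemxAr mul_mxrow.
rewrite !blockZ mxrowK trmx1 mulmx1 /sub_dz mulNmx opprK -!scalemxAl !scalerA.
by congr (_ *: _); field; rewrite gt_eqF.
Qed.

(** The form of W is that of the block-diagonal part plus alpha / b times the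
    form of U on the sum of the blocks, and U >= 0. *)
Lemma sub_dF_bounded xi W : dF xi W ->
  sym_bounded (2 * m) (K + 2 * alpha * b%:R) W.
Proof.
move=> [H [U [HC UC ->]]].
have Hb i := sym_bounded_clarke (ltW m_gt0) (pG i) (HC i).
have [Usym Ub] := sym_bounded_clarke (lexx 0) thetaP UC.
have ab : 0 < alpha / b%:R by rewrite divr_gt0.
have innE u w : inner (u *m (\mxdiag_i H i
      + (alpha * b%:R) *: (sub_A *m U *m sub_A^T))) w
    = \sum_i inner (blk u i *m H i) (blk w i)
      + alpha / b%:R * inner (block_sum u *m U) (block_sum w).
  rewrite inner_blocks inner_block_sumr mulr_sumr -big_split /=.
  apply: eq_bigr => i _; rewrite sub_dF_block /sub_dz innerDl; congr (_ + _).
  by rewrite mulNmx opprK -scalemxAl innerZl.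
split=> [u w|u].
  rewrite !innE Usym; congr (_ + _).
  by apply: eq_bigr => i _; case: (Hb i) => ->.
rewrite innE enorm_blocks; apply/andP; split.
  rewrite -[leLHS]addr0 mulr_sumr; apply: lerD.
    by apply: ler_sum => i _; case: (Hb i) => _ /(_ (blk u i))/andP[].
  have /andP[+ _] := Ub (block_sum u); rewrite mulr0 mul0r => U0.
  by rewrite mulr_ge0 // ltW.
rewrite mulrDl; apply: lerD.
  rewrite mulr_sumr.
  by apply: ler_sum => i _; case: (Hb i) => _ /(_ (blk u i))/andP[].
rewrite -enorm_blocks; have /andP[_ hi] := Ub (block_sum u).
apply: le_trans (ler_wpM2l (ltW ab) hi) _.
have sq : enorm (block_sum u) ^+ 2 <= (b%:R * enorm u) ^+ 2.
  by rewrite ler_pXn2r ?nnegrE ?enorm_ge0 ?mulr_ge0 ?enorm_ge0 ?block_sum_le.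
have c0 : 0 <= alpha / b%:R * 2 by rewrite mulr_ge0 // ltW.
rewrite mulrA; apply: le_trans (ler_wpM2l c0 sq) _.
rewrite exprMn le_eqVlt; apply/orP; left; apply/eqP; field.
by rewrite gt_eqF.
Qed.

Lemma sub_F_dirdiff xi :
  (forall i, directionally_differentiable (G i) (blk xi i)) ->
  directionally_differentiable P (z xi) -> directionally_differentiable F xi.
Proof.
move=> Gd Pd h.
have /cvg_ex[/= lP] := Pd (sub_dz h); move=> /cvg_enormP/cvgrPdist_lt hP.
pose lG i := proj1_sig (cid ((cvg_ex _).1 (Gd i (blk h i)))).
have hG i : (fun t : R => t^-1 *: (G i (blk xi i + t *: blk h i) - G i (blk xi i)))
    @ 0^'+ --> lG i by rewrite /lG; case: cid.
apply/cvg_ex; exists (\mxrow_i (lG i - lP) : VV); apply/cvg_enormP.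
apply/cvgrPdist_lt => e e0.
have e2 : 0 < e / (b%:R + 1) / 2 by rewrite !divr_gt0 // addr_gt0.
have hG' : \forall t \near (0 : R)^'+, forall i,
    enorm (t^-1 *: (G i (blk xi i + t *: blk h i) - G i (blk xi i)) - lG i)
      < e / (b%:R + 1) / 2.
  apply: filter_forall => i; have /cvg_enormP/cvgrPdist_lt/(_ _ e2) := hG i.
  by apply: filterS => t; rewrite sub0r normrN ger0_norm ?enorm_ge0.
apply: filterS (filterI hG' (hP _ e2)) => t [hGt].
rewrite !sub0r !normrN !ger0_norm ?enorm_ge0 // => hPt.
apply: le_lt_trans (_ : _ <= b%:R * (e / (b%:R + 1))) _; last first.
  by rewrite mulrCA gtr_pMr // ltr_pdivrMr ?addr_gt0 // mul1r ltrDl.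
apply: enorm_le_blocks_cst => i.
have -> : blk (t^-1 *: (F (xi + t *: h) - F xi) - \mxrow_i (lG i - lP)) i
  = (t^-1 *: (G i (blk xi i + t *: blk h i) - G i (blk xi i)) - lG i)
    - (t^-1 *: (P (z xi + t *: sub_dz h) - P (z xi)) - lP).
  have := sub_F_blockB xi (xi + t *: h) i.
  move: (F (xi + _)) (F xi) => f1 f2.
  move=> fE; rewrite [LHS]blockB mxrowK blockZ fE blockD blockZ sub_zD sub_dzZ
    scalerBr.
  move: (t^-1 *: _) (t^-1 *: _) => g1 g2.
  by rewrite !opprD !opprK addrACA.
apply: le_trans (enormBD _ _) _.
by rewrite [leRHS]splitr; apply: lerD; apply: ltW => //; exact: hGt.
Qed.

(** Block by block, the linearization error of F is that of a gradient of a
    conjugate minus that of prox along the affine map z.  The modulus r is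
    a |-> eps a for semismoothness and a |-> C a^(1 + nu) for the nu-order
    version. *)
Lemma sub_gap (r : R -> R) xi :
  {in Num.nneg &, {homo r : a c / a <= c}} ->
  (forall i, \forall s \near (0 : 'rV[R]_n), forall H,
    clarke (G i) (blk xi i + s) H ->
    enorm (G i (blk xi i + s) - G i (blk xi i) - s *m H) <= r (enorm s)) ->
  (\forall s \near (0 : 'rV[R]_n), forall U, clarke P (z xi + s) U ->
    enorm (P (z xi + s) - P (z xi) - s *m U) <= r (enorm s)) ->
  \forall s \near (0 : VV), forall W, dF (xi + s) W ->
    enorm (F (xi + s) - F xi - s *m W) <= b%:R * (r (enorm s) + r (alpha * enorm s)).
Proof.
move=> r_homo Gr /near0_enormP[dP dP0 Pr].
pose bound i (s : VV) := forall H, clarke (G i) (blk xi i + blk s i) H ->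
    enorm (G i (blk xi i + blk s i) - G i (blk xi i) - blk s i *m H)
      <= r (enorm (blk s i)).
have Gr' : \forall s \near (0 : VV), forall i, bound i s.
  apply: (@filter_forall _ _ bound (nbhs (0 : VV))) => i;
    have /near0_enormP[dG dG0 GP] := Gr i.
  apply/near0_enormP; exists dG => // s sd; apply: GP.
  exact: le_lt_trans (block_le _ _) sd.
have near_dz : \forall s \near (0 : VV), enorm (sub_dz s) < dP.
  apply/near0_enormP; exists (dP / alpha); first by rewrite divr_gt0.
  move=> s; rewrite ltr_pdivlMr // mulrC; apply: le_lt_trans.
  exact: sub_dz_le.
apply: filterS (filterI Gr' near_dz) => s [GP sdz] W [H [U [HC UC ->]]].
apply: enorm_le_blocks_cst => i.
move: (HC i) UC; rewrite sub_zD blockD => HCi UC.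
have h2 := GP i _ HCi; have h1 := Pr _ sdz _ UC.
have := sub_F_blockB xi (xi + s) i; have := sub_dF_block s H U i.
move: (F (xi + s)) (F xi) (s *m _) => f1 f2 sW sWE fE.
rewrite blockB sWE fE blockD sub_zD.
rewrite [X in enorm X](_ : _ = (G i (blk xi i + blk s i) - G i (blk xi i) - blk s
  i *m H i)
    - (P (z xi + sub_dz s) - P (z xi) - sub_dz s *m U)); last first.
  move: (G i _ - _) (P _ - _) (blk s i *m _) (_ *m U) => g q gH qU.
  by rewrite !opprD !opprK addrACA.
apply: le_trans (enormBD _ _) _; apply: lerD.
  by apply: le_trans h2 _; apply: r_homo; rewrite ?nnegrE ?enorm_ge0 // block_le.
apply: le_trans h1 _; apply: r_homo; rewrite ?nnegrE ?enorm_ge0 //.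
  by rewrite mulr_ge0 ?enorm_ge0 // ltW.
exact: sub_dz_le.
Qed.

End Subproblem.

(** * The two subproblems *)

Section SubproblemNewton.
Context {R : realType} {n b : nat}.

Lemma finite_positive_lb (a : 'I_b -> R) : (forall i, 0 < a i) ->
  exists2 c : R, 0 < c & forall i, c <= a i.
Proof.
move=> a0; pose S := 1 + \sum_i (a i)^-1.
have S0 : 0 < S by rewrite ltr_pwDl // sumr_ge0 // => i _; rewrite invr_ge0 ltW.
exists S^-1; first by rewrite invr_gt0.
move=> i; rewrite -[a i]invrK lef_pV2 ?posrE ?invr_gt0 // /S (bigD1 i) //=.
rewrite addrCA lerDl addr_ge0 // sumr_ge0 // => j _; rewrite invr_ge0 ltW //.
Qed.

Lemma finite_ub (a : 'I_b -> R) : exists2 c : R, 0 < c & forall i, a i <= c.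
Proof.
exists (1 + \sum_i `|a i|); first by rewrite ltr_pwDl // sumr_ge0.
move=> i; rewrite (bigD1 i) //= addrCA; apply: le_trans (ler_norm _) _.
by rewrite lerDl addr_ge0 // sumr_ge0.
Qed.

(** Lets the finitely many functions p i share their constants. *)
Lemma convex_gradient_weaken (m m' K K' : R) (f : 'rV[R]_n -> R) G :
  m' <= m -> K <= K' -> convex_gradient m K f G -> convex_gradient m' K' f G.
Proof.
move=> mm KK [lb lip]; split=> u w.
  apply: le_trans (lb u w); rewrite lerD2l.
  by rewrite ler_wpM2r ?sqr_ge0.
by apply: le_trans (lip u w) _; rewrite ler_wpM2r ?enorm_ge0.
Qed.

Lemma semismooth_gap_le p (F : 'rV[R]_n -> 'rV[R]_p) x s (c : R) M :
  (semismooth_gap F x s <= c%:E)%E -> clarke F (x + s) M ->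
  enorm (F (x + s) - F x - s *m M) <= c.
Proof.
move=> gap cM; rewrite -lee_fin; apply: le_trans gap.
by apply: ereal_sup_ubound; exists M.
Qed.

Variables (p : 'I_b -> 'rV[R]_n -> R) (theta : 'rV[R]_n -> \bar R).
Variables (alpha : R) (x v : 'rV[R]_n) (gamma rho tau1 tau2 tau : R).
Notation F := (sub_F p theta alpha x v).
Hypotheses (b_gt0 : (0 < b)%N) (alpha_gt0 : 0 < alpha)
  (theta_ccp : closed_convex_proper theta)
  (theta_ss : semismooth_on setT (prox (escale alpha theta)))
  (p_smooth : forall i, exists mu L : R, [/\ 0 < mu, 0 < L, strongly_convex mu (p i),
     forall y, differentiable (p i : 'rV[R]_n -> R^o) y
   & forall y z, enorm (grad (p i) z - grad (p i) y) <= L * enorm (z - y)])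
  (p_ss : forall i, semismooth_on (intdom_conj (p i)) (grad_conj (p i)))
  (gamma_itv : 0 < gamma < 1 / 2) (rho_itv : 0 < rho < 1)
  (tau1_itv : 0 < tau1 < 1) (tau2_itv : 0 < tau2 < 1) (tau_itv : 0 < tau <= 1).

Let domT i y : intdom_conj (p i) y.
Proof.
have [mu [L [mu0 L0 sc df lip]]] := p_smooth i.
exact: intdom_conjT mu0 sc df _.
Qed.

Let conj_gradient : exists m K : R, [/\ 0 < m, 0 < K &
  forall i, convex_gradient m K (fine \o conj (p i)) (grad_conj (p i))].
Proof.
have H i : exists mK : R * R, 0 < mK.1 /\
    convex_gradient mK.1 mK.2 (fine \o conj (p i)) (grad_conj (p i)).
  have [mu [L [mu0 L0 sc df lip]]] := p_smooth i.
  exists ((4 * L)^-1, 2 / mu); split; last exact: convex_gradient_conj.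
  by rewrite invr_gt0 mulr_gt0.
pose mK i := proj1_sig (cid (H i)).
have mKP i : 0 < (mK i).1 /\
    convex_gradient (mK i).1 (mK i).2 (fine \o conj (p i)) (grad_conj (p i)).
  by rewrite /mK; case: cid.
have [m m0 mle] := finite_positive_lb (fun i => (mKP i).1).
have [K K0 Kge] := finite_ub (fun i => (mK i).2).
exists m, K; split=> // i.
exact: convex_gradient_weaken (mle i) (Kge i) (mKP i).2.
Qed.

(** The x and y subproblems are both of this form: p ranges over the selected
    phi^x_{y,i} with theta = phi, respectively over the phi^y_{x,i} with
    theta = psi. *)
Lemma subproblem_newton (xi : nat -> 'rV[R]_(\sum_(i < b) n)) :
  newton_sequence (sub_dom p) (sub_I p theta alpha x v) F (sub_dF p theta alpha x v)
    gamma rho tau1 tau2 tau xi ->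
  exists xhat, [/\ unique_solution (sub_dom p) F xhat, q_superlinear xi xhat
    & forall nu : R, 0 < nu <= 1 ->
      nu_semismooth_on nu setT (prox (escale alpha theta)) ->
      (forall i, nu_semismooth_on nu (intdom_conj (p i)) (grad_conj (p i))) ->
      q_rate (1 + Num.min tau nu) xi xhat].
Proof.
move=> [_ step]; have [m [K [m0 K0 pG]]] := conj_gradient.
have thetaP := convex_gradient_env (closed_convex_proper_scale alpha_gt0 theta_ccp).
have DT xi' : sub_dom p xi' by move=> i.
have IF := sub_convex_gradient x v b_gt0 alpha_gt0 K0 pG thetaP.
have dFb := @sub_dF_bounded _ _ _ p theta alpha x v m K b_gt0 alpha_gt0 m0 pG thetaP.
set Kt := b%:R * (K + 2 * alpha) in IF.
have b0 : 0 < b%:R :> R by rewrite ltr0n.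
have Kt0 : 0 < Kt by rewrite mulr_gt0 // addr_gt0 // mulr_gt0.
have M0 : 0 < K + 2 * alpha * b%:R by rewrite addr_gt0 // !mulr_gt0.
have m20 : 0 < 2 * m by rewrite mulr_gt0.
have [xhat F0 xi_cvg] := newton_sequence_cvg DT m0 Kt0 m20 M0 IF dFb
  gamma_itv rho_itv tau1_itv tau2_itv step.
have ddF : directionally_differentiable F xhat.
  apply: (sub_F_dirdiff b_gt0) => [i|]; last exact: (theta_ss.2 _ Logic.I).1.
  exact: ((p_ss i).2 _ (domT i _)).1.
have ssF (eps : R) : 0 < eps -> \forall s \near (0 : 'rV[R]_(\sum_(i < b) n)),
    forall W, sub_dF p theta alpha x v (xhat + s) W ->
    enorm (F (xhat + s) - F xhat - s *m W) <= eps * enorm s.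
  move=> eps0; pose eps' := eps / (b%:R * (1 + alpha)).
  have eps'0 : 0 < eps' by rewrite divr_gt0 // mulr_gt0 // addr_gt0.
  have near_gap k (Q : 'rV[R]_n -> 'rV[R]_k) y : semismooth_at Q y ->
      \forall s \near (0 : 'rV[R]_n), forall M, clarke Q (y + s) M ->
        enorm (Q (y + s) - Q y - s *m M) <= eps' * enorm s.
    move=> [_ /(_ _ eps'0)]; apply: filterS => s gap M.
    exact: semismooth_gap_le gap.
  have E s : b%:R * (eps' * enorm s + eps' * (alpha * enorm s))
      = eps * enorm (s : 'rV[R]_(\sum_(i < b) n)).
    by rewrite /eps'; field; rewrite !gt_eqF // addr_gt0.
  have := @sub_gap _ _ _ p theta alpha x v b_gt0 alpha_gt0 (fun a => eps' * a) xhat.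
  move=> gap; apply: filterS (gap _ _ _) => [s sgap W dFW|a c _ _ ac|i|].
  - by rewrite -E; exact: sgap.
  - by rewrite ler_pM2l.
  - by apply: near_gap; exact: ((p_ss i).2 _ (domT i _)).
  - by apply: near_gap; exact: (theta_ss.2 _ Logic.I).
exists xhat; split.
- split=> // y _ Fy0; apply/eqP; rewrite -subr_eq0; apply/eqP/enorm_eq0/eqP.
  rewrite eq_le enorm_ge0 andbT -(pmulr_rle0 _ m20).
  by have := gradient_expands IF xhat y; rewrite Fy0 F0 subrr enorm0.
- exact: (newton_q_superlinear DT m0 Kt0 m20 M0 IF dFb gamma_itv tau1_itv tau2_itv
    tau_itv F0 ddF ssF step xi_cvg).
move=> nu nu01 [_ theta_nu] p_nu.
have [C0 hC0] := (theta_nu (sub_z alpha x v xhat) Logic.I).2.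
have /choice[C hC] : forall i, exists c : R, \forall s \near (0 : 'rV[R]_n),
    (semismooth_gap (grad_conj (p i)) (submxrow xhat i) s
      <= (c * enorm s `^ (1 + nu))%:E)%E.
  by move=> i; exact: ((p_nu i).2 _ (domT i _)).2.
have [C1 C10 C1ge] := finite_ub C.
pose Cm := Num.max C0 C1.
have Cm0 : 0 <= Cm by rewrite le_max (ltW C10) orbT.
have [nu0 _] := andP nu01.
have near_gap k (Q : 'rV[R]_n -> 'rV[R]_k) y c : c <= Cm ->
    (\forall s \near (0 : 'rV[R]_n), (semismooth_gap Q y s
      <= (c * enorm s `^ (1 + nu))%:E)%E) ->
    \forall s \near (0 : 'rV[R]_n), forall M, clarke Q (y + s) M ->
      enorm (Q (y + s) - Q y - s *m M) <= Cm * enorm s `^ (1 + nu).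
  move=> cC; apply: filterS => s gap M /(semismooth_gap_le gap)/le_trans; apply.
  by rewrite ler_wpM2r ?powR_ge0.
apply: (newton_q_rate (C := b%:R * (Cm + Cm * alpha `^ (1 + nu))) DT m0 Kt0 m20 M0 IF
  dFb gamma_itv tau1_itv tau2_itv tau_itv F0 ddF ssF step xi_cvg nu01).
have := @sub_gap _ _ _ p theta alpha x v b_gt0 alpha_gt0
  (fun a => Cm * a `^ (1 + nu)) xhat.
move=> gap; apply: filterS (gap _ _ _) => [s sgap W dFW|a c a0 c0 ac|i|].
- apply: le_trans (sgap W dFW) _.
  by rewrite powRM ?enorm_ge0 ?(ltW alpha_gt0) // mulrA -mulrDl mulrA.
- apply: ler_wpM2l => //; apply: ge0_ler_powR => //.
  by rewrite addr_ge0 // ltW.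
- by apply: near_gap (hC i); rewrite le_max C1ge orbT.
- by apply: near_gap hC0; rewrite le_max lexx.
Qed.

End SubproblemNewton.

Section SubproblemFunctions.
Context {R : realType} {n m N : nat}.
Implicit Types (f : 'rV[R]_n -> 'rV[R]_m -> R).

Lemma differentiable_partial1 f y x : C1_2 f ->
  differentiable (f ^~ y : 'rV[R]_n -> R^o) x.
Proof.
case=> df _ _.
apply: (@differentiable_comp _ _ _ _ (fun u : 'rV[R]_n => (u, y))
  (fun q => f q.1 q.2 : R^o)); last exact: df.
exact: differentiable_pair.
Qed.

Lemma differentiable_partial2 f x y : C1_2 f ->
  differentiable (f x : 'rV[R]_m -> R^o) y.
Proof.
case=> df _ _.
apply: (@differentiable_comp _ _ _ _ (fun u : 'rV[R]_m => (x, u))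
  (fun q => f q.1 q.2 : R^o)); last exact: df.
exact: differentiable_pair.
Qed.

Lemma gradD k (g h : 'rV[R]_k -> R) x :
  differentiable (g : 'rV[R]_k -> R^o) x -> differentiable (h : 'rV[R]_k -> R^o) x ->
  grad (fun u => g u + h u) x = grad g x + grad h x.
Proof.
move=> dg dh; apply/rowP => i; rewrite !mxE.
by rewrite (@diffD _ _ _ (g : _ -> R^o) (h : _ -> R^o)).
Qed.

Lemma gradN k (g : 'rV[R]_k -> R) x : differentiable (g : 'rV[R]_k -> R^o) x ->
  grad (fun u => - g u) x = - grad g x.
Proof.
by move=> dg; apply/rowP => i; rewrite !mxE (@diffN _ _ _ (g : _ -> R^o)).
Qed.

Lemma pair_norm0r (u : 'rV[R]_n) : pair_norm u (0 : 'rV[R]_m) = enorm u.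
Proof. by rewrite /pair_norm enorm0 expr0n addr0 sqrtr_sqr ger0_norm ?enorm_ge0. Qed.

Lemma pair_norm0l (u : 'rV[R]_m) : pair_norm (0 : 'rV[R]_n) u = enorm u.
Proof. by rewrite /pair_norm enorm0 expr0n add0r sqrtr_sqr ger0_norm ?enorm_ge0. Qed.

Variables (g : 'I_N -> 'rV[R]_n -> R) (h : 'I_N -> 'rV[R]_m -> R)
  (f : 'I_N -> 'rV[R]_n -> 'rV[R]_m -> R).
Hypotheses (gC1 : forall i, C1 (g i)) (hC1 : forall i, C1 (h i))
  (fC1 : forall i, C1_2 (f i)) (A1 : assumption_A1 g h f).

Lemma phix_smooth y i : exists mu L : R, [/\ 0 < mu, 0 < L,
     strongly_convex mu (phix g f y i),
     forall u, differentiable (phix g f y i : 'rV[R]_n -> R^o) u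
   & forall u w, enorm (grad (phix g f y i) w - grad (phix g f y i) u)
       <= L * enorm (w - u)].
Proof.
have [_ [Lg [Lh [Lf [mux [muy [[Lg0 Lh0 Lf0 mux0 muy0]]]]]]]] := A1 i.
case=> gL hL fL gfsc hfsc.
have dg u := (gC1 i).1 u; have df u := differentiable_partial1 y u (fC1 i).
exists mux, (Lg + Lf); split=> //; first by rewrite addr_gt0.
- exact: gfsc.
- by move=> u; exact: (differentiableD (dg u) (df u)).
move=> u w; rewrite /phix !gradD // -/(grad1 (f i) w y) -/(grad1 (f i) u y).
rewrite opprD addrACA mulrDl; apply: le_trans (enormD _ _) _; apply: lerD => //.
have := fL u y w y; rewrite ge_max => /andP[+ _].
by rewrite (subrr y) pair_norm0r.
Qed.

Lemma phiy_smooth x i : exists mu L : R, [/\ 0 < mu, 0 < L,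
     strongly_convex mu (phiy h f x i),
     forall u, differentiable (phiy h f x i : 'rV[R]_m -> R^o) u
   & forall u w, enorm (grad (phiy h f x i) w - grad (phiy h f x i) u)
       <= L * enorm (w - u)].
Proof.
have [_ [Lg [Lh [Lf [mux [muy [[Lg0 Lh0 Lf0 mux0 muy0]]]]]]]] := A1 i.
case=> gL hL fL gfsc hfsc.
have dh u := (hC1 i).1 u; have df u := differentiable_partial2 x u (fC1 i).
have dfN u : differentiable ((fun y => - f i x y) : 'rV[R]_m -> R^o) u.
  exact: (differentiableN (df u)).
exists muy, (Lh + Lf); split=> //; first by rewrite addr_gt0.
- have := hfsc x; rewrite /strongly_concave; congr strongly_convex.
  by apply/funext => u; rewrite /phiy opprD opprK.
- by move=> u; exact: (differentiableD (dh u) (dfN u)).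
move=> u w; rewrite /phiy !gradD // !gradN // -/(grad2 (f i) x w) -/(grad2 (f i) x u).
rewrite opprD addrACA mulrDl; apply: le_trans (enormD _ _) _; apply: lerD => //.
have := fL x u x w; rewrite ge_max => /andP[_ +].
by rewrite (subrr x) pair_norm0l -opprD enormN.
Qed.

End SubproblemFunctions.

Theorem theorem3p5 (R : realType) (n m q N b : nat)
  (g : 'I_N -> 'rV[R]_n -> R) (h : 'I_N -> 'rV[R]_m -> R)
  (f : 'I_N -> 'rV[R]_n -> 'rV[R]_m -> R)
  (phi : 'rV[R]_n -> \bar R) (psi : 'rV[R]_m -> \bar R)
  (A : 'M[R]_(q, n)) (B : 'M[R]_(q, m)) (c : 'rV[R]_q)
  (gC1 : forall i, C1 (g i)) (hC1 : forall i, C1 (h i))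
  (fC1 : forall i, C1_2 (f i))
  (phi_ccp : closed_convex_proper phi) (psi_ccp : closed_convex_proper psi)
  (prox_ss : prox_semismooth phi psi)
  (A1 : assumption_A1 g h f) (A2 : assumption_A2 g h f phi psi A B c)
  (A3 : assumption_A3 g h f) (A4 : assumption_A4 g h f)
  (b_gt0 : (0 < b)%N) (kappa : 'I_b -> 'I_N)
  (alpha : R) (alpha_gt0 : 0 < alpha)
  (x vx : 'rV[R]_n) (y vy : 'rV[R]_m)
  (yfix : 'rV[R]_m) (xfix : 'rV[R]_n)
  (gamma rho tau1 tau2 tau : R)
  (gamma_itv : 0 < gamma < 1 / 2) (rho_itv : 0 < rho < 1)
  (tau1_itv : 0 < tau1 < 1) (tau2_itv : 0 < tau2 < 1)
  (tau_itv : 0 < tau <= 1)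
  (xix : nat -> 'rV[R]_(\sum_(i < b) n)) (xiy : nat -> 'rV[R]_(\sum_(i < b) m)) :
  let px := fun i => phix g f yfix (kappa i) in
  let py := fun i => phiy h f xfix (kappa i) in
  let Dx := sub_dom px in
  let Dy := sub_dom py in
  let Fx := sub_F px phi alpha x vx in
  let Fy := sub_F py psi alpha y vy in
  newton_sequence Dx (sub_I px phi alpha x vx) Fx (sub_dF px phi alpha x vx)
    gamma rho tau1 tau2 tau xix ->
  newton_sequence Dy (sub_I py psi alpha y vy) Fy (sub_dF py psi alpha y vy)
    gamma rho tau1 tau2 tau xiy ->
  exists (xhat : 'rV[R]_(\sum_(i < b) n)) (yhat : 'rV[R]_(\sum_(i < b) m)),
  [/\ unique_solution Dx Fx xhat /\ unique_solution Dy Fy yhat,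
      q_superlinear xix xhat /\ q_superlinear xiy yhat
    & forall nu : R, 0 < nu <= 1 ->
        assumption_A5 nu phi psi -> assumption_A6 nu g h f ->
        q_rate (1 + Num.min tau nu) xix xhat /\
        q_rate (1 + Num.min tau nu) xiy yhat].
Proof.
move=> px py Dx Dy Fx Fy xix_newton xiy_newton.
have [xhat [xuniq xsuper xrate]] := subproblem_newton b_gt0 alpha_gt0 phi_ccp
  (prox_ss alpha alpha_gt0).1 (fun i => phix_smooth gC1 fC1 A1 yfix (kappa i))
  (fun i => A4.1 (kappa i) yfix) gamma_itv rho_itv tau1_itv tau2_itv tau_itv
    xix_newton.
have [yhat [yuniq ysuper yrate]] := subproblem_newton b_gt0 alpha_gt0 psi_ccp
  (prox_ss alpha alpha_gt0).2 (fun i => phiy_smooth hC1 fC1 A1 xfix (kappa i))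
  (fun i => A4.2 (kappa i) xfix) gamma_itv rho_itv tau1_itv tau2_itv tau_itv
    xiy_newton.
exists xhat, yhat; split=> // nu nu01 A5 A6.
have [A5x A5y] := A5 alpha alpha_gt0; have [A6x A6y] := A6.
split.
  by apply: xrate => // i; exact: A6x.
by apply: yrate => // i; exact: A6y.
Qed.
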